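(* Let $d\ge2$ be a fixed integer, let $\varepsilon>0$ be fixed, let $p=\frac{(1+\varepsilon)d\log n}{n}$ and $Y=Y(n,p;d)$. There exists a constant $C>0$ such that with high probability the spectral gap of $Y$ satisfies $$\delta(Y)-C\sqrt{\log n}\le\lambda(Y)\le\delta(Y).$$
   Context: $\log$ is the natural logarithm. $Y(n,p;d)$ is the random $d$-dimensional simplicial complex on $[n]$ containing all subsets of size at most $d$ as faces, in which each $(d+1)$-subset of $[n]$ is a $d$-face independently with probability $p$; $Y^{(j)}$ is the set of $j$-faces ($(j+1)$-element faces). With high probability means with probability tending to $1$ as $n\to\infty$. For $\sigma\in Y^{(d-1)}$, $\deg(\sigma)$ is the number of $d$-faces containing $\sigma$, and $\delta(Y)=\min_{\sigma\in Y^{(d-1)}}\deg(\sigma)$. Spectral gap: an oriented $j$-face is a $j$-face with an ordering of its vertices up to even permutations; $\bar\sigma$ is the opposite orientation. $\Omega^{(j)}$ is the real vector space of functions $f$ on oriented $j$-faces with $f(\bar\sigma)=-f(\sigma)$, with inner product $\langle f,g\rangle=\sum_{\sigma\in Y^{(j)}}f(\sigma)g(\sigma)$ (one orientation per face). For $\sigma=[v_0,\dots,v_j]$ and $v\notin\sigma$, $v\sigma=[v,v_0,\dots,v_j]$. The boundary operator $\partial_j:\Omega^{(j)}\to\Omega^{(j-1)}$ is $(\partial_jf)(\sigma)=\sum_{v:\,\sigma\cup\{v\}\in Y^{(j)}}f(v\sigma)$, and the coboundary $\delta_{d-1}:\Omega^{(d-1)}\to\Omega^{(d)}$ is $(\delta_{d-1}f)([v_0,\dots,v_d])=\sum_{i=0}^d(-1)^if([v_0,\dots,\widehat{v_i},\dots,v_d])$.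 The (combinatorial) upper Laplacian is $\Delta^+=\partial_d\delta_{d-1}$ on $\Omega^{(d-1)}$, $Z_{d-1}=\ker\partial_{d-1}$, and the spectral gap is $\lambda(Y)=\min\mathrm{Spec}(\Delta^+|_{Z_{d-1}})$. *)

(* Defs.v *)
From mathcomp Require Import all_boot all_order all_fingroup all_algebra.
From mathcomp Require Import all_classical all_reals all_analysis.

Set Implicit Arguments.
Unset Strict Implicit.
Unset Printing Implicit Defensive.

Import Order.TTheory GRing.Theory Num.Theory.
Import numFieldNormedType.Exports.

Local Open Scope ring_scope.

(** A complex on the vertex set ['I_n] is the set of all its faces (the empty
    face included). A [j]-face has [j + 1] vertices. *)

Section Complexes.
Context {n : nat}.
Implicit Types (Y : {set {set 'I_n}}) (s : {set 'I_n}).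

Definition faces Y (j : nat) : {set {set 'I_n}} :=
  [set s in Y | #|s| == j.+1]%SET.

Definition deg Y (d : nat) s : nat :=
  #|[set t in faces Y d | s \subset t]%SET|.

End Complexes.

(** The minimum of [A]; the default value [0] is taken when [A] has no
    minimum. *)
Definition set_min {R : realType} (A : set R) : R :=
  xget 0 (A `&` lbound A)%classic.

Definition min_deg (R : realType) {n : nat} (d : nat)
    (Y : {set {set 'I_n}}) : R :=
  set_min [set x | exists2 s, s \in faces Y d.-1 & x = (deg Y d s)%:R]%classic.

(** An ordering of a [j]-face is a duplicate-free [j + 1]-tuple. A function on
    oriented [j]-faces that changes sign under reversal of the orientation is
    the same thing as a function on orderings of [j]-faces on which a
    permutation of the vertices acts by its signature. Such a function is
    extended by [0] to the tuples that are not orderings of a face, so that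
    the elements of [forms Y] that live on [k]-tuples are the (k-1)-forms. *)

Section Forms.
Context {R : realType} {n : nat}.
Context (Y : {set {set 'I_n}}).

Definition ordering (k : nat) (t : k.-tuple 'I_n) : bool :=
  uniq t && ([set x in t]%SET \in Y).

Definition forms {k : nat} : set {ffun k.-tuple 'I_n -> R} :=
  [set f : {ffun k.-tuple 'I_n -> R} |
     (forall t, ~~ ordering t -> f t = 0) /\
     (forall (t : k.-tuple 'I_n) (s : 'S_k),
        f [tuple tnth t (s i) | i < k] = (-1) ^+ s * f t)]%classic.

(** [boundary j] is the operator from [j]-forms to [(j-1)]-forms. *)
Definition boundary (j : nat) (f : {ffun j.+1.-tuple 'I_n -> R}) :
    {ffun j.-tuple 'I_n -> R} :=
  [ffun t => if ordering t then
               \sum_(v | (v |: [set x in t])%SET \in faces Y j)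
                 f [tuple of v :: t]
             else 0].

(** [coboundary j] is the operator from [j]-forms to [(j+1)]-forms. *)
Definition coboundary (j : nat) (f : {ffun j.+1.-tuple 'I_n -> R}) :
    {ffun j.+2.-tuple 'I_n -> R} :=
  [ffun t => if ordering t then
               \sum_(i < j.+2)
                 (-1) ^+ i * f [tuple tnth t (lift i m) | m < j.+1]
             else 0].

Definition upper_laplacian (j : nat) (f : {ffun j.+1.-tuple 'I_n -> R}) :
    {ffun j.+1.-tuple 'I_n -> R} :=
  boundary (coboundary f).

Definition cycles {j : nat} : set {ffun j.+1.-tuple 'I_n -> R} :=
  [set f | forms f /\ boundary f = 0]%classic.

(** Eigenvalues of the restriction of the upper Laplacian to [cycles j]. *)
Definition spectrum (j : nat) : set R :=
  [set a | exists f : {ffun j.+1.-tuple 'I_n -> R},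
     [/\ cycles f, f != 0 & forall t, upper_laplacian f t = a * f t]]%classic.

End Forms.

Definition spectral_gap (R : realType) {n : nat} (d : nat)
    (Y : {set {set 'I_n}}) : R :=
  set_min (spectrum Y d.-1).

(** The random complex Y(n,p;d): its set [F] of [d]-faces is a random set of
    (d+1)-subsets of ['I_n] distributed according to the product Bernoulli
    measure. *)

Definition subsets_of_card (n k : nat) : {set {set 'I_n}} :=
  [set s : {set 'I_n} | #|s| == k]%SET.

Definition complex_of (n d : nat) (F : {set {set 'I_n}}) : {set {set 'I_n}} :=
  ([set s : {set 'I_n} | (#|s| <= d)%N] :|: F)%SET.

Definition prob_Y {R : realType} (n : nat) (p : R) (d : nat)
    (E : {set {set 'I_n}} -> Prop) : R :=
  \sum_(F : {set {set 'I_n}} |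
          (F \subset subsets_of_card n d.+1) && `[< E (complex_of d F) >])
    \prod_(s in subsets_of_card n d.+1) (if s \in F then p else 1 - p).

(** [prob_Y (p n) d] is a probability only when [0 <= p n <= 1]; it suffices for
    the limit that this holds for all large [n]. *)
Definition whp {R : realType} (p : nat -> R) (d : nat)
    (E : forall n, {set {set 'I_n}} -> Prop) : Prop :=
  ((fun n => prob_Y (p n) d (@E n)) @ \oo --> (1 : R))%classic.

(* Main.v *)
Require Import Defs.
From mathcomp Require Import all_boot all_order all_fingroup all_algebra.
From mathcomp Require Import all_classical all_reals all_analysis.
From mathcomp Require Import ring lra zify.

Set Implicit Arguments.
Unset Strict Implicit.
Unset Printing Implicit Defensive.

Import Order.TTheory GRing.Theory Num.Theory.
Import numFieldNormedType.Exports.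

Local Open Scope ring_scope.

(** Let [A] be the signed adjacency operator, so that [Delta^+ = D - A] with [D]
    the degree operator.  The quadratic form of [A] at [f] is, up to
    normalisation, the sum over the [(d-2)]-faces [rho] of the quadratic forms
    of the graph adjacency matrices of the links at [f_rho(v) = f(v rho)], and
    [f] is a cycle exactly when every [f_rho] is orthogonal to the constants.
    Hence the lower bound follows once every centred link matrix [X_rho] has
    norm [O(sqrt(log n))], with failure probability [o(n^(1-d))] for each
    [rho].

    The norm is controlled by [E tr X_rho^m] with [m] of order [log n].  Only
    closed walks using every edge at least twice contribute, and a walk with
    [v] vertices has weight at most [p^(v-1)].  Comparing [n (n-1) ... (n-v+1)
    p^(v-1)] with [r (r-1) ... (r-v+1)] for [r >= n p + m] replaces [X_rho] by
    an [r] by [r] random matrix with i.i.d. bounded centred entries, whose norm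
    is [O(sqrt r)] by a net argument; [r], [m] and [log n] have the same order,
    so the size of the net only costs a factor [exp(O(m))].

    For the upper bound, let [sigma] have minimal degree and let [N] be the set
    of vertices completing [sigma] to a [d]-face.  Let [h] be the coboundary of
    the indicator of [sigma] in the complete complex on the complement of [N].
    The cycle [f = partial h] has a coboundary vanishing on the [d]-faces that
    avoid [N], and the other [d]-faces contribute at most [|N| |f|^2] to the
    Rayleigh quotient. *)

(** * Quadratic forms and traces *)

Lemma cauchy_schwarz_sum (R : realFieldType) (I : finType) (a b : I -> R) :
  (\sum_i a i * b i) ^+ 2 <= (\sum_i a i ^+ 2) * (\sum_i b i ^+ 2).
Proof.
rewrite -subr_ge0.
(* Lagrange's identity: the defect is half the sum of the squared 2 by 2 minors. *)
have -> : (\sum_i a i ^+ 2) * (\sum_i b i ^+ 2) - (\sum_i a i * b i) ^+ 2 =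
   2^-1 * \sum_i \sum_j (a i * b j - a j * b i) ^+ 2.
  have E : \sum_i \sum_j (a i * b j - a j * b i) ^+ 2 =
    \sum_i \sum_j (a i ^+ 2 * b j ^+ 2) + \sum_i \sum_j (a j ^+ 2 * b i ^+ 2)
     - 2 * \sum_i \sum_j (a i * b i) * (a j * b j).
    rewrite mulr_sumr -big_split -sumrB; apply: eq_bigr => i _ /=.
    rewrite mulr_sumr -big_split -sumrB; apply: eq_bigr => j _ /=; ring.
  rewrite E [X in _ + X - _]exchange_big /= -!big_distrlr /= expr2.
  by field.
apply: mulr_ge0; first by rewrite invr_ge0.
by apply: sumr_ge0 => i _; apply: sumr_ge0 => j _; rewrite sqr_ge0.
Qed.

Section QuadTrace.
Variables (R : realFieldType) (n : nat).
Implicit Types (M : 'M[R]_n) (x : 'cV[R]_n).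

Definition quad M x : R := (x^T *m (M *m x)) 0 0.
Definition nrm2 x : R := \sum_i x i 0 ^+ 2.

Lemma nrm2_ge0 x : 0 <= nrm2 x.
Proof. by apply: sumr_ge0 => i _; rewrite sqr_ge0. Qed.

Lemma quadE M x : quad M x = \sum_i x i 0 * (M *m x) i 0.
Proof. by rewrite /quad mxE; apply: eq_bigr => i _; rewrite mxE. Qed.

Lemma quad_sqr M x : M^T = M -> quad (M *m M) x = nrm2 (M *m x).
Proof.
move=> sM; rewrite /quad -mulmxA mulmxA -{1}sM -trmx_mul mxE.
by apply: eq_bigr => i _; rewrite mxE expr2.
Qed.

Lemma quad_sqr_le M x : M^T = M -> quad M x ^+ 2 <= quad (M *m M) x * nrm2 x.
Proof.
move=> sM; rewrite quad_sqr // mulrC quadE; exact: cauchy_schwarz_sum.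
Qed.

(** For symmetric [M] the trace of the square is the squared Frobenius norm, so Cauchy-Schwarz
    applies row by row. *)
Lemma quad_sqr_trace M x : M^T = M -> quad (M *m M) x <= \tr (M *m M) * nrm2 x.
Proof.
move=> sM; rewrite quad_sqr // /mxtrace mulr_suml; apply: ler_sum => i _.
rewrite [(M *m M) i i]mxE [(M *m x) i 0]mxE.
have -> : \sum_j M i j * M j i = \sum_j M i j ^+ 2.
  by apply: eq_bigr => j _; rewrite expr2; congr (_ * _); rewrite -{1}sM mxE.
exact: cauchy_schwarz_sum.
Qed.

Lemma trmx_sqr M : M^T = M -> (M *m M)^T = M *m M.
Proof. by move=> sM; rewrite trmx_mul sM. Qed.

(** Repeated squaring: Cauchy-Schwarz bounds the square of the form of [M] by the form of its
    square, to which the induction applies. This is why the moments are later taken at powers of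
    two. *)
Lemma quad_le_trace M x j : M^T = M ->
  quad M x ^+ (2 ^ j.+1) <= \tr (M ^+ (2 ^ j.+1)) * nrm2 x ^+ (2 ^ j.+1).
Proof.
elim: j M => [|j IH] M sM.
  rewrite expn1; apply: le_trans (quad_sqr_le x sM) _.
  by rewrite [nrm2 x ^+ 2]expr2 mulrA ler_wpM2r ?nrm2_ge0 ?quad_sqr_trace.
rewrite expnS exprM; apply: (le_trans (y := (quad (M *m M) x * nrm2 x) ^+ (2 ^ j.+1))).
  by rewrite lerXn2r ?nnegrE ?sqr_ge0 ?quad_sqr_le // mulr_ge0 ?quad_sqr ?nrm2_ge0.
rewrite exprMn exprM [M ^+ 2]expr2.
apply: le_trans (ler_wpM2r _ (IH _ (trmx_sqr sM))) _; first by rewrite exprn_ge0 ?nrm2_ge0.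
by rewrite -mulrA -exprD addnn -mul2n.
Qed.

End QuadTrace.

(** * Closed walks *)

Section Walks.
Variable V : finType.

(** Edges are unordered, so both directions of traversal count as the same edge; a step that stays
    in place gives a singleton. *)
Definition steps (x : V) (s : seq V) : seq {set V} := pairmap (fun a b => [set a; b]) x s.
Definition doubled (T : eqType) (es : seq T) : bool := all (fun e => 1 < count_mem e es)%N es.

Lemma steps_sub x s e : e \in steps x s -> {subset e <= x :: s}.
Proof.
elim: s x => [|y s IH] x //=; rewrite inE => /orP [/eqP ->|/IH H] z.
  by rewrite !inE => /orP [] /eqP ->; rewrite eqxx ?orbT.
by move=> /H zin; rewrite inE zin orbT.
Qed.

(** If the first vertex does not recur, neither does the first edge, which contains it; so every new
    vertex costs a new edge. *)
Lemma card_vertices_steps x s :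
  (#|[set y in x :: s]| <= (size (undup (steps x s))).+1)%N.
Proof.
elim: s x => [|y s IH] x.
  by rewrite (_ : [set y in [:: x]] = [set x]) ?cards1 //; apply/setP => z; rewrite !inE.
have -> : [set z in x :: y :: s] = x |: [set z in y :: s].
  by apply/setP => z; rewrite !inE.
rewrite cardsU1 inE /=; have [xin|xout] /= := boolP (x \in y :: s).
  apply: leq_trans (IH y) _; rewrite ltnS; case: ifP => //= _.
case: ifP => [H|_] /=; last by rewrite add1n ltnS.
case/negP: xout; apply: (steps_sub H); by rewrite !inE eqxx.
Qed.

End Walks.

Lemma sum_tuple_cons (R : nmodType) (V : finType) m (F : m.+1.-tuple V -> R) :
  \sum_t F t = \sum_a \sum_(s : m.-tuple V) F [tuple of a :: s].
Proof.
rewrite pair_bigA /=.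
rewrite (reindex (fun p : V * m.-tuple V => [tuple of p.1 :: p.2])) //=.
exists (fun t : m.+1.-tuple V => (thead t, [tuple of behead t])) => [[a s] _|t _] /=.
  by rewrite theadE; congr pair; apply: val_inj.
by rewrite -tuple_eta.
Qed.

Lemma expmx_walks (R : comPzRingType) n (xi : {set 'I_n} -> R) m x y :
  ((\matrix_(a, b) xi [set a; b] : 'M[R]_n) ^+ m) x y =
  \sum_(s : m.-tuple 'I_n) (last x s == y)%:R * \prod_(e <- steps x s) xi e.
Proof.
elim: m x => [|m IH] x.
  rewrite expr0 (big_pred1 [tuple]) => [|s]; last by rewrite [s]tuple0; apply/esym/eqP/val_inj.
  by rewrite big_nil mulr1 mxE.
rewrite exprS mxE sum_tuple_cons; apply: eq_bigr => a _.
rewrite IH mulr_sumr; apply: eq_bigr => s _ /=.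
by rewrite big_cons mxE mulrCA.
Qed.

Lemma trace_expmx_walks (R : comPzRingType) n (xi : {set 'I_n} -> R) m :
  \tr ((\matrix_(a, b) xi [set a; b] : 'M[R]_n) ^+ m) =
  \sum_x \sum_(s : m.-tuple 'I_n) (last x s == x)%:R * \prod_(e <- steps x s) xi e.
Proof. by apply: eq_bigr => x _; rewrite expmx_walks. Qed.

(** * Counting tuples by their set of values *)

Section ByImage.
Variables (R : comPzSemiRingType) (k : nat) (P : forall V : finType, k.-tuple V -> bool).
Hypothesis P_inj : forall (U V : finType) (h : U -> V) (t : k.-tuple U),
  injective h -> P (map_tuple h t) = P t.

Definition onto_count (v : nat) : nat :=
  #|[set t : k.-tuple 'I_v | P t & [set x in t] == finset.setT]|.

Lemma card_image_eq (V : finType) (A : {set V}) :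
  #|[set t : k.-tuple V | P t & [set x in t] == A]| = onto_count #|A|.
Proof.
pose h (i : 'I_#|A|) : V := enum_val i.
have hinj : injective h by exact: enum_val_inj.
rewrite /onto_count -(card_imset _ (f := fun t => map_tuple h t)); last first.
  by move=> t1 t2 /(congr1 val) /= /(inj_map hinj) /val_inj.
apply/esym/eq_card => t; rewrite !inE; apply/imsetP/idP => [[u]|/andP [Pt /eqP eA]].
  rewrite inE => /andP [Pu /eqP uT] ->; rewrite P_inj // Pu /=.
  apply/eqP/setP => y; rewrite inE; apply/mapP/idP => [[i _ ->]|yA]; first exact: enum_valP.
  exists (enum_rank_in yA y); last by rewrite /h enum_rankK_in.
  have : enum_rank_in yA y \in [set x in u] by rewrite uT inE.
  by rewrite inE.
have tA i : tnth t i \in A by rewrite -eA inE mem_tnth.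
pose u := [tuple enum_rank_in (tA i) (tnth t i) | i < k].
have tE : t = map_tuple h u.
  by apply: eq_from_tnth => i; rewrite tnth_map tnth_mktuple /h enum_rankK_in.
exists u => //; rewrite inE -(P_inj _ hinj) -tE Pt /=; apply/eqP/setP => i; rewrite !inE.
have : h i \in [set x in t] by rewrite eA; exact: enum_valP.
by rewrite inE tE => /mapP [j ju /hinj ->].
Qed.

(** A property invariant under injective relabelling has the same number of tuples onto any set of
    [v] elements. The size of [V] then enters only through binomial coefficients, and sums over
    vertex sets of different sizes can be compared term by term. *)
Lemma sum_by_image (V : finType) (phi : nat -> R) :
  \sum_(t : k.-tuple V | P t) phi #|[set x in t]| =
  \sum_(v < k.+1) ('C(#|V|, v) * onto_count v)%:R * phi v.
Proof.
have card_le (t : k.-tuple V) : (#|[set x in t]| < k.+1)%N.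
  by rewrite ltnS cardsE (leq_trans (card_size _)) ?size_tuple.
rewrite (partition_big (fun t : k.-tuple V => inord #|[set x in t]| : 'I_k.+1) predT) //=.
apply: eq_bigr => v _.
rewrite (eq_bigr (fun=> phi v)) => [|t /andP [_ /eqP <-]]; last by rewrite inordK.
rewrite sumr_const mulr_natl; congr (_ *+ _).
transitivity (\sum_(A : {set V} | #|A| == v)
    #|[set t : k.-tuple V | P t & [set x in t] == A]|)%N; last first.
  rewrite (eq_bigr (fun=> onto_count v)) => [|A /eqP <-]; last exact: card_image_eq.
  rewrite sum_nat_const -card_draws; congr (_ * _)%N.
  by apply: eq_card => A; rewrite !inE.
rewrite -sum1_card (partition_big (fun t : k.-tuple V => [set x in t]) (fun A => #|A| == v)) /=.
  apply: eq_bigr => A /eqP vA; rewrite -sum1_card; apply: eq_bigl => t.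
  rewrite !inE -andbA; congr (_ && _); apply/andb_idl => /eqP ->.
  by rewrite vA; apply/eqP/val_inj; rewrite /= inordK.
by move=> t; rewrite unfold_in => /andP [_ /eqP <-]; rewrite inordK.
Qed.

End ByImage.

Lemma ffact_le_expn n v : (n ^_ v <= n ^ v)%N.
Proof.
elim: v => [|v IH]; first by rewrite ffactn0.
by rewrite ffactnSr expnSr leq_mul ?leq_subr.
Qed.

Lemma expn_le_ffact r v : (0 < v)%N -> ((r - v.-1) ^ v <= r ^_ v)%N.
Proof.
move=> v0; rewrite ffact_prod -[X in (_ ^ X)%N]card_ord -prod_nat_const leq_prod // => i _.
by apply: leq_sub2l; rewrite -ltnS prednK.
Qed.

(** After multiplication by v! both binomials are falling factorials: that of n is at most n^v, and
    every factor of that of r is at least r - v + 1, hence at least n q. The extra factor n on the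
    right appears because q occurs only v - 1 times. *)
Lemma bin_compare (R : realFieldType) (n r m v : nat) (q : R) :
  0 <= q -> n%:R * q + m%:R <= r%:R -> (0 < v <= m.+1)%N -> (m < r)%N ->
  'C(n, v)%:R * q ^+ v.-1 <= n%:R * 'C(r, v)%:R.
Proof.
case: v => [//|v] q0 H /andP [_ vm] mr /=.
rewrite -(ler_pM2r (x := v.+1`!%:R)); last by rewrite ltr0n fact_gt0.
have E N : 'C(N, v.+1)%:R * v.+1`!%:R = (N ^_ v.+1)%:R :> R by rewrite -natrM bin_ffact.
rewrite mulrAC -[leRHS]mulrA !E.
apply: (le_trans (y := (n ^ v.+1)%:R * q ^+ v)).
  by rewrite ler_wpM2r ?exprn_ge0 // ler_nat ffact_le_expn.
apply: (le_trans (y := n%:R * ((r - v) ^ v.+1)%:R)); last first.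
  by rewrite ler_wpM2l // ler_nat (expn_le_ffact r (ltn0Sn v)).
rewrite expnS natrM -mulrA ler_wpM2l // !natrX -exprMn.
have step : n%:R * q <= (r - v)%:R.
  rewrite natrB; last by apply: leq_trans (vm : (v <= m)%N) (ltnW mr).
  have : (v%:R : R) <= m%:R by rewrite ler_nat.
  by lra.
apply: (le_trans (y := (r - v)%:R ^+ v)).
  by rewrite lerXn2r // nnegrE // mulr_ge0.
rewrite [leRHS]exprS ler_peMl ?exprn_ge0 // ler1n subn_gt0.
exact: leq_ltn_trans (vm : (v <= m)%N) mr.
Qed.

Lemma map_steps (U V : finType) (h : U -> V) x s :
  steps (h x) (map h s) = map (fun e : {set U} => h @: e) (steps x s).
Proof.
elim: s x => [|y s IH] x //=; rewrite IH; congr (_ :: _).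
by rewrite imsetU !imset_set1.
Qed.

Lemma doubled_map (T U : eqType) (h : T -> U) (es : seq T) :
  injective h -> doubled (map h es) = doubled es.
Proof.
move=> hi; rewrite /doubled all_map; apply: eq_all => e /=.
by rewrite count_map; congr (_ < _)%N; apply: eq_count => f /=; rewrite (inj_eq hi).
Qed.

(** A closed walk of m steps is listed together with its final vertex, hence the m + 1 entries. *)
Definition closed_doubled m (V : finType) (t : m.+1.-tuple V) : bool :=
  (last (thead t) t == thead t) && doubled (steps (thead t) (behead t)).

Lemma closed_doubled_map m (U V : finType) (h : U -> V) (t : m.+1.-tuple U) :
  injective h -> closed_doubled (map_tuple h t) = closed_doubled t.
Proof.
move=> hi; rewrite (tuple_eta t) /closed_doubled !theadE /=.
have -> : thead (map_tuple h [tuple of thead t :: behead t]) = h (thead t) by [].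
rewrite last_map (inj_eq hi) map_steps doubled_map //.
by apply: imset_inj.
Qed.

Definition doubled_walks m (V : finType) : nat := #|[set t : m.+1.-tuple V | closed_doubled t]|.

Lemma doubled_walks_compare (R : realFieldType) (n r m : nat) (q : R) :
  0 <= q -> n%:R * q + m%:R <= r%:R -> (m < r)%N ->
  \sum_(t : m.+1.-tuple 'I_n | closed_doubled t) q ^+ #|[set x in t]|.-1 <=
  n%:R * (doubled_walks m 'I_r)%:R.
Proof.
move=> q0 H mr.
pose P := (fun (V : finType) (t : m.+1.-tuple V) => closed_doubled t).
have Pinj (U V : finType) (h : U -> V) (t : m.+1.-tuple U) : injective h -> P V (map_tuple h t) = P U t.
  exact: closed_doubled_map.
rewrite (sum_by_image Pinj 'I_n (fun v => q ^+ v.-1)).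
have -> : (doubled_walks m 'I_r)%:R = \sum_(t : m.+1.-tuple 'I_r | closed_doubled t) 1 :> R.
  by rewrite sumr_const; congr (_%:R); apply: eq_card => t; rewrite inE.
rewrite (sum_by_image Pinj 'I_r (fun=> 1)) mulr_sumr; apply: ler_sum => v _.
rewrite mulr1 !natrM mulrAC mulrA !card_ord.
have [v0|v0] := posnP v; last first.
  by rewrite ler_wpM2r // (@bin_compare _ n r m) // v0 -ltnS ltn_ord.
(* A walk has at least one vertex, so the truncated exponent [v.-1] at v = 0 does no harm. *)
have -> : onto_count P v = 0%N.
  rewrite v0; apply/eqP; rewrite cards_eq0; apply/eqP/setP => t.
  by case: (thead t).
by rewrite !mulr0.
Qed.

Lemma prod_count (R : comPzSemiRingType) (T : finType) (F : T -> R) (es : seq T) :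
  \prod_(e <- es) F e = \prod_e F e ^+ count_mem e es.
Proof.
elim: es => [|e es IH]; first by rewrite big_nil big1.
rewrite big_cons IH [in RHS](bigD1 e) //= eqxx add1n exprS -mulrA; congr (_ * _).
rewrite (bigD1 e) //=; congr (_ * _); apply: eq_bigr => f /negPf fe.
by rewrite eq_sym fe.
Qed.

(** For centred variables the linear term cancels and a sub-Gaussian bound remains. Up to 1/2 the
    bound follows from e^x <= 1/(1 - x); beyond 1/2 one has x <= 2 x^2. *)
Lemma expR_le_quad (R : realType) (x : R) : expR x <= x + expR (2 * x ^+ 2).
Proof.
have key (u : R) : 1 + 2 * u ^+ 2 <= expR (2 * u ^+ 2) by exact: expR_ge1Dx.
have [x2|x2] := lerP x (1 / 2).
  apply: (@le_trans _ _ (x + (1 + 2 * x ^+ 2))); last by rewrite lerD2l key.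
  have h : 0 < 1 - x by lra.
  have := expR_ge1Dx (- x); rewrite expRN => Hx.
  have : expR x <= (1 - x)^-1.
    by rewrite -[leLHS]invrK lef_pV2 // posrE invr_gt0 expR_gt0.
  move=> /le_trans; apply.
  rewrite -[leLHS]mul1r ler_pdivrMr //; nra.
apply: (@le_trans _ _ (expR (2 * x ^+ 2))); last by lra.
by rewrite ler_expR; nra.
Qed.

(** * The comparison matrix *)

(* A centred law all of whose moments of order at least 2 are at least 1, the
   odd ones included: no symmetrisation of the link matrices is needed. *)
Section Three.
Variable R : realType.
Definition val3 (i : 'I_3) : R := if i == 0 then 2 else - 1.

Lemma sum_val3 (f : R -> R) : \sum_i f (val3 i) = f 2 + f (- 1) + f (- 1).
Proof. by rewrite !big_ord_recr big_ord0 /= add0r. Qed.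

Lemma moment3_ge0 c : 0 <= \sum_i val3 i ^+ c.
Proof.
rewrite (sum_val3 (fun x => x ^+ c)) -signr_odd.
have : (1 : R) <= 2 ^+ c by rewrite exprn_ege1 // ler1n.
case: c => [|c] /=; first by rewrite expr0; lra.
rewrite [2 ^+ c.+1]exprS => H.
have : (1 : R) <= 2 ^+ c by rewrite exprn_ege1 // ler1n.
by case: (~~ odd c) => /=; rewrite ?expr1 ?expr0; lra.
Qed.

Lemma moment3_ge3 c : c != 1%N -> 3 <= \sum_i val3 i ^+ c.
Proof.
rewrite (sum_val3 (fun x => x ^+ c)) -signr_odd.
case: c => [|[//|[|c]]] /= _; [by rewrite expr0; lra| by rewrite expr0; lra |].
rewrite negbK 3!exprS.
have : (1 : R) <= 2 ^+ c by rewrite exprn_ege1 // ler1n.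
by case: (~~ odd c) => /=; rewrite ?expr1 ?expr0; lra.
Qed.

(** The linear terms 2t - t - t cancel, and 8 t^2 is the larger exponent 2 (2t)^2. *)
Lemma expR_val3 (t : R) : \sum_i expR (t * val3 i) <= 3 * expR (8 * t ^+ 2).
Proof.
rewrite (sum_val3 (fun x => expR (t * x))).
have h2 := expR_le_quad (t * 2); have h1 := expR_le_quad (t * (- 1)).
have e2 : 2 * (t * 2) ^+ 2 = 8 * t ^+ 2 by ring.
have e1 : expR (2 * (t * - 1) ^+ 2) <= expR (8 * t ^+ 2).
  by rewrite ler_expR; have := sqr_ge0 t; nra.
by move: h2; rewrite e2; lra.
Qed.

Variable T : finType.
Implicit Types g : {ffun T -> 'I_3}.

(** The sum over outcomes factors into moments, one for each element of [T]. In a doubled list no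
    multiplicity equals 1, so every moment is at least 3; otherwise nonnegativity suffices. *)
Lemma sum_prod_val3 (es : seq T) :
  (3 ^+ #|T|) * (doubled es)%:R <= \sum_(g : {ffun T -> 'I_3}) \prod_(e <- es) val3 (g e) :> R.
Proof.
have -> : \sum_(g : {ffun T -> 'I_3}) \prod_(e <- es) val3 (g e) = \prod_e \sum_i val3 i ^+ count_mem e es.
  rewrite bigA_distr_bigA; apply: eq_bigr => g _.
  exact: (prod_count (fun e => val3 (g e))).
have [/allP de|_] := boolP (doubled es); last first.
  by rewrite mulr0 prodr_ge0 // => e _; exact: moment3_ge0.
rewrite mulr1 -prodr_const; apply: ler_prod => e _; rewrite ler0n /=.
apply: moment3_ge3; apply/eqP => c1.
have : e \in es by rewrite -has_pred1 has_count c1.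
by move=> /de; rewrite c1.
Qed.

Lemma sum_expR_val3 (c : T -> R) :
  \sum_(g : {ffun T -> 'I_3}) expR (\sum_e c e * val3 (g e)) <= 3 ^+ #|T| * expR (8 * \sum_e c e ^+ 2).
Proof.
have -> : \sum_(g : {ffun T -> 'I_3}) expR (\sum_e c e * val3 (g e)) = \prod_e \sum_i expR (c e * val3 i).
  by rewrite bigA_distr_bigA; apply: eq_bigr => g _; rewrite expR_sum.
rewrite mulr_sumr expR_sum -prodr_const -big_split /=.
apply: ler_prod => e _; rewrite expR_val3 andbT.
by apply: sumr_ge0 => i _; exact: expR_ge0.
Qed.

Lemma even_pow_le_expR (x : R) k : x ^+ k.*2 / (k.*2)`!%:R <= expR x + expR (- x).
Proof.
case: k => [|k].
  rewrite double0 fact0 expr0 divr1.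
  have := expR_ge1Dx x; have := expR_ge1Dx (- x); lra.
have pos (y : R) : 0 <= y -> y ^+ k.+1.*2 / (k.+1.*2)`!%:R <= expR y.
  by move=> y0; have := @expR_ge1Dxn R y k.*2.+1 y0; rewrite doubleS; lra.
have [x0|x0] := lerP 0 x.
  by apply: (le_trans (pos _ x0)); rewrite lerDl expR_ge0.
have nx : 0 <= - x by lra.
have := pos _ nx; rewrite exprNn -signr_odd odd_double expr0 mul1r => /le_trans; apply.
by rewrite lerDr expR_ge0.
Qed.

(** An even power of t times the sum is bounded by its factorial times the exponentials at t and at
    -t; the parameter t is left free, to be chosen as a function of r. *)
Lemma sum_pow_val3 (c : T -> R) (t B : R) k : 0 < t -> \sum_e c e ^+ 2 <= B ->
  \sum_(g : {ffun T -> 'I_3}) (\sum_e c e * val3 (g e)) ^+ k.*2 <=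
  3 ^+ #|T| * (2 * (k.*2)`!%:R * expR (8 * t ^+ 2 * B)) / t ^+ k.*2.
Proof.
move=> t0 cB; rewrite ler_pdivlMr ?exprn_gt0 // mulr_suml.
have f0 : (0 : R) < (k.*2)`!%:R by rewrite ltr0n fact_gt0.
have bnd (s : R) : s ^+ 2 = t ^+ 2 ->
    \sum_(g : {ffun T -> 'I_3}) expR (\sum_e (s * c e) * val3 (g e)) <= 3 ^+ #|T| * expR (8 * t ^+ 2 * B).
  move=> st; apply: (le_trans (sum_expR_val3 _)).
  rewrite ler_wpM2l ?exprn_ge0 // ler_expR -mulrA ler_wpM2l //.
  under eq_bigr do rewrite exprMn st.
  by rewrite -mulr_sumr ler_wpM2l ?sqr_ge0.
apply: (@le_trans _ _ (\sum_(g : {ffun T -> 'I_3}) (k.*2)`!%:R * (expR (\sum_e (t * c e) * val3 (g e)) +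
     expR (\sum_e (- t * c e) * val3 (g e))))).
  apply: ler_sum => g _; rewrite [leLHS]mulrC -exprMn -ler_pdivrMl // [leLHS]mulrC.
  have E (s : R) : \sum_e (s * c e) * val3 (g e) = s * \sum_e c e * val3 (g e).
    by rewrite mulr_sumr; apply: eq_bigr => e _; rewrite mulrA.
  by rewrite !E mulNr; exact: even_pow_le_expR.
rewrite -mulr_sumr big_split /=.
have H1 := bnd t erefl; have H2 := bnd (- t) (sqrrN t).
have -> : 3 ^+ #|T| * (2 * (k.*2)`!%:R * expR (8 * t ^+ 2 * B)) =
  (k.*2)`!%:R * (3 ^+ #|T| * expR (8 * t ^+ 2 * B) + 3 ^+ #|T| * expR (8 * t ^+ 2 * B)) by ring.
by rewrite ler_wpM2l ?lerD // ltW.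
Qed.

End Three.

(** * The net argument *)

Section Net.
Variables (R : realType) (r : nat).
Hypothesis r0 : (0 < r)%N.

Definition bil (G : 'M[R]_r) (x y : 'I_r -> R) : R := \sum_i \sum_j x i * G i j * y j.
Definition sqn (x : 'I_r -> R) : R := \sum_i x i ^+ 2.

Lemma bilC (G : 'M[R]_r) x y : G^T = G -> bil G x y = bil G y x.
Proof.
move=> sG; rewrite /bil exchange_big /=; apply: eq_bigr => i _; apply: eq_bigr => j _.
by rewrite -{1}sG mxE; ring.
Qed.

Lemma bilE (G : 'M[R]_r) x y : bil G x y = \sum_i x i * \sum_j G i j * y j.
Proof. by apply: eq_bigr => i _; rewrite mulr_sumr; apply: eq_bigr => j _; ring. Qed.

Lemma bilZ (G : 'M[R]_r) a b x y :
  bil G (fun i => a * x i) (fun i => b * y i) = a * b * bil G x y.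
Proof.
rewrite /bil mulr_sumr; apply: eq_bigr => i _; rewrite mulr_sumr; apply: eq_bigr => j _; ring.
Qed.

Lemma sqnZ a x : sqn (fun i => a * x i) = a ^+ 2 * sqn x.
Proof. by rewrite /sqn mulr_sumr; apply: eq_bigr => i _; rewrite exprMn. Qed.

Lemma sqn_ge0 x : 0 <= sqn x.
Proof. by apply: sumr_ge0 => i _; exact: sqr_ge0. Qed.

(* Signed integers of absolute value at most [9 r]; zero has two codes, which
   only makes the net larger. *)
Definition code := (bool * 'I_(9 * r).+1)%type.
Definition cval (c : code) : R := (-1) ^+ c.1 * (c.2 : nat)%:R.
Definition in_net (z : {ffun 'I_r -> code}) : bool := (\sum_i (z i).2 ^ 2 <= 9 * r)%N.
Definition zval (z : {ffun 'I_r -> code}) (i : 'I_r) : R := cval (z i).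

Lemma sqn_zval z : sqn (zval z) = (\sum_i (z i).2 ^ 2)%:R.
Proof.
rewrite natr_sum; apply: eq_bigr => i _.
by rewrite /zval /cval exprMn sqrr_sign mul1r natrX.
Qed.

Lemma sqn_in_net z : in_net z -> sqn (zval z) <= (9 * r)%:R.
Proof. by move=> zT; rewrite sqn_zval ler_nat. Qed.

(** Each point is weighted by 2 to the power minus the sum of the |z_i|, which on the net is at
    least 2^(-9r), since |z_i| <= z_i^2. The total weight is a product of geometric sums, at most 2
    for each sign, so at most 4 per coordinate. *)
Lemma card_net : \sum_(z | in_net z) 1 <= 2 ^+ (11 * r) :> R.
Proof.
have half_gt0 : (0 : R) < 2^-1 by rewrite invr_gt0.
apply: (@le_trans _ _ (2 ^+ (9 * r) * \sum_(z : {ffun 'I_r -> code}) \prod_i (2^-1) ^+ (z i).2)).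
  rewrite mulr_sumr [leRHS](bigID in_net) /=; apply: ler_wpDr.
    by apply: sumr_ge0 => z _; rewrite mulr_ge0 ?exprn_ge0 // prodr_ge0 // => i _; rewrite exprn_ge0 // ltW.
  apply: ler_sum => z zT; rewrite prodrXr exprVn ler_pdivlMr ?exprn_gt0 // mul1r.
  rewrite ler_eXn2l ?ltr1n //; apply: leq_trans zT; apply: leq_sum => i _.
  by case: (nat_of_ord (z i).2) => // m; rewrite expnS leq_pmulr.
have geo n : \sum_(m < n) (2^-1 : R) ^+ m <= 2.
  suff -> : \sum_(m < n) (2^-1 : R) ^+ m = 2 - 2 * 2^-1 ^+ n.
    by rewrite lerBlDr lerDl mulr_ge0 // exprn_ge0 // ltW.
  elim: n => [|n IH]; first by rewrite big_ord0 expr0; ring.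
  by rewrite big_ord_recr /= IH exprS; field.
have -> : \sum_(z : {ffun 'I_r -> code}) \prod_i (2^-1) ^+ (z i).2 = 
    \prod_(i < r) \sum_(c : code) (2^-1 : R) ^+ c.2.
  by rewrite bigA_distr_bigA.
rewrite (_ : 11 * r = 9 * r + 2 * r)%N; last by ring.
rewrite exprD ler_wpM2l ?exprn_ge0 // prodr_const card_ord exprM.
rewrite lerXn2r ?nnegrE ?exprn_ge0 //.
  by apply: sumr_ge0 => c _; rewrite exprn_ge0 // ltW.
rewrite -(pair_bigA _ (fun (b : bool) (m : 'I_(9 * r).+1) => (2^-1 : R) ^+ m)) /=.
have := geo (9 * r).+1; rewrite sumr_const card_bool mulr2n expr2; lra.
Qed.

(* Rounding in the direction of [g] increases the product, so no convexity
   argument is needed to pass from the ball to the net. *)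
Lemma round_dir (y g : R) : exists z : int, `|z%:~R - y| <= 1 /\ y * g <= z%:~R * g.
Proof.
have [g0|g0] := lerP 0 g.
  exists (Num.ceil y); have := ceil_itv y; rewrite intrB => /andP [h1 h2].
  by split; [rewrite ler_norml; apply/andP; split; lra | rewrite ler_wpM2r].
exists (Num.floor y); have := floor_itv y; rewrite intrD => /andP [h1 h2].
split; first by rewrite ler_norml; apply/andP; split; lra.
by rewrite ler_nM2r.
Qed.

Lemma net_dominates (u g : 'I_r -> R) : sqn u <= (4 * r)%:R ->
  exists2 z, in_net z & \sum_i u i * g i <= \sum_i zval z i * g i.
Proof.
move=> u4.
pose zi i := projT1 (cid (round_dir (u i) (g i))).
have [zi1 zi2] : (forall i, `|(zi i)%:~R - u i| <= 1) /\
    (forall i, u i * g i <= (zi i)%:~R * g i).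
  by split=> i; rewrite /zi; case: (cid _) => z /= [].
have zE i : (zi i)%:~R = (-1) ^+ (zi i < 0)%R * (`|zi i|%N)%:R :> R.
  by rewrite [in LHS](intEsign (zi i)) intrM rmorphXn /= intrN.
have znorm : (\sum_i `|zi i|%N ^ 2 <= 9 * r)%N.
  rewrite -(ler_nat R) natr_sum.
  (* With |w| <= 1 one has (u + w)^2 <= 3/2 u^2 + 3. Summed over the coordinates this gives 6r + 3r
     = 9r, the squared radius of the net. *)
  have : \sum_i (`|zi i|%N ^ 2)%:R <= \sum_i (3 / 2 * u i ^+ 2 + 3 : R).
    apply: ler_sum => i _; have := zi1 i; rewrite ler_norml => /andP [h1 h2].
    have -> : (`|zi i|%N ^ 2)%:R = (zi i)%:~R ^+ 2 :> R.
      by rewrite zE exprMn sqrr_sign mul1r natrX.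
    set w := (zi i)%:~R - u i in h1 h2.
    have -> : (zi i)%:~R = u i + w by rewrite /w; ring.
    have := sqr_ge0 (u i - 2 * w); nra.
  move=> /le_trans; apply.
  rewrite big_split /= -mulr_sumr sumr_const card_ord -[3 *+ r]mulr_natr.
  move: u4; rewrite /sqn !natrM; lra.
have zlt i : (`|zi i|%N < (9 * r).+1)%N.
  rewrite ltnS; apply: leq_trans znorm; rewrite (bigD1 i) //=.
  apply: leq_trans (leq_addr _ _); by case: `|zi i|%N => // m; rewrite expnS leq_pmulr.
pose z : {ffun 'I_r -> code} := [ffun i => ((zi i < 0)%R, inord `|zi i|%N)].
have zv i : zval z i = (zi i)%:~R by rewrite /zval ffunE /cval /= inordK // zE.
exists z; last by apply: ler_sum => i _; rewrite zv.
rewrite /in_net (eq_bigr (fun i => `|zi i|%N ^ 2)%N) // => i _.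
by rewrite ffunE /= inordK.
Qed.

(** The arguments are rounded in turn: u in the direction G w, then w in the direction G z, where z
    is the net point found for u. *)
Lemma net_bound (G : 'M[R]_r) (B : R) : G^T = G ->
  (forall z z', in_net z -> in_net z' -> bil G (zval z) (zval z') <= B) ->
  forall u w, sqn u <= (4 * r)%:R -> sqn w <= (4 * r)%:R -> bil G u w <= B.
Proof.
move=> sG HB u w u4 w4.
have [z zT hz] := net_dominates (fun i => \sum_j G i j * w j) u4.
have [z' zT' hz'] := net_dominates (fun i => \sum_j G i j * zval z j) w4.
rewrite bilE; apply: (le_trans hz); rewrite -bilE bilC // bilE.
by apply: (le_trans hz'); rewrite -bilE bilC //; exact: HB.
Qed.

(** By homogeneity both vectors can be rescaled to squared length 4r, unless one of them
    vanishes. *)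
Lemma bil_le (G : 'M[R]_r) (B : R) : 0 <= B ->
  (forall u w, sqn u <= (4 * r)%:R -> sqn w <= (4 * r)%:R -> bil G u w <= B) ->
  forall x y, (4 * r)%:R * bil G x y <= B * (Num.sqrt (sqn x) * Num.sqrt (sqn y)).
Proof.
move=> B0 HB x y.
have r4 : (0 : R) < (4 * r)%:R by rewrite ltr0n muln_gt0.
have zero u : sqn u = 0 -> forall i, u i = 0.
  move=> u0 i; apply/eqP; rewrite -sqrf_eq0; apply/eqP.
  by apply: (psumr_eq0P _ u0) => // j _; exact: sqr_ge0.
have [x0|x0] := eqVneq (sqn x) 0.
  rewrite {1}/bil big1 ?mulr0 ?mulr_ge0 ?sqrtr_ge0 // => i _.
  by rewrite big1 // => j _; rewrite zero // !mul0r.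
have [y0|y0] := eqVneq (sqn y) 0.
  rewrite {1}/bil big1 ?mulr0 ?mulr_ge0 ?sqrtr_ge0 // => i _.
  by rewrite big1 // => j _; rewrite (zero y) // mulr0.
have xp : 0 < sqn x by rewrite lt0r x0 sqn_ge0.
have yp : 0 < sqn y by rewrite lt0r y0 sqn_ge0.
set a := Num.sqrt (sqn x); set b := Num.sqrt (sqn y); pose s : R := Num.sqrt (4 * r)%:R.
have ap : 0 < a by rewrite sqrtr_gt0. have bp : 0 < b by rewrite sqrtr_gt0.
have sE : s ^+ 2 = (4 * r)%:R by rewrite sqr_sqrtr // ltW.
have aE : a ^+ 2 = sqn x by rewrite sqr_sqrtr // ltW.
have bE : b ^+ 2 = sqn y by rewrite sqr_sqrtr // ltW.
have := HB (fun i => (s / a) * x i) (fun i => (s / b) * y i).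
rewrite !sqnZ !exprMn !exprVn aE bE sE !divfK //.
move=> /(_ (lexx _) (lexx _)); rewrite bilZ.
have -> : s / a * (s / b) = s ^+ 2 / (a * b) by field; rewrite !gt_eqF.
by rewrite sE mulrAC ler_pdivrMr // mulr_gt0.
Qed.

(** The bilinear bound at the pair (G x, x), after cancelling one factor |G x|. *)
Lemma nrm2_mulmx_le (G : 'M[R]_r) (B : R) : G^T = G -> 0 <= B ->
  (forall x y, (4 * r)%:R * bil G x y <= B * (Num.sqrt (sqn x) * Num.sqrt (sqn y))) ->
  forall x : 'cV[R]_r, (4 * r)%:R ^+ 2 * nrm2 (G *m x) <= B ^+ 2 * nrm2 x.
Proof.
move=> sG B0 HB x.
have := HB (fun i => (G *m x) i 0) (fun i => x i 0).
rewrite bilE; have -> : \sum_i (G *m x) i 0 * (\sum_j G i j * x j 0) = nrm2 (G *m x).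
  by apply: eq_bigr => i _; rewrite expr2; congr (_ * _); rewrite mxE.
rewrite -[sqn (fun i => (G *m x) i 0)]/(nrm2 (G *m x)) -[sqn (fun i => x i 0)]/(nrm2 x).
set a := nrm2 (G *m x); set b := nrm2 x.
have a0 : 0 <= a := nrm2_ge0 _. have b0 : 0 <= b := nrm2_ge0 _.
have aE : Num.sqrt a ^+ 2 = a by rewrite sqr_sqrtr.
have bE : Num.sqrt b ^+ 2 = b by rewrite sqr_sqrtr.
have := sqrtr_ge0 a; have := sqrtr_ge0 b.
move: aE bE; set sa := Num.sqrt a; set sb := Num.sqrt b => aE bE sb0 sa0.
rewrite -aE -bE -!exprMn => H.
have n0 : (0 : R) <= (4 * r)%:R by [].
have [->|san] := eqVneq sa 0; first by rewrite mulr0 expr0n /= sqr_ge0.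
rewrite lerXn2r ?nnegrE ?mulr_ge0 //.
have sap : 0 < sa by rewrite lt0r san.
rewrite -(ler_pM2r sap); apply: le_trans (le_trans H _); rewrite ?expr2; lra.
Qed.

(** The maximum over net pairs, divided by 4r, bounds the operator norm, and the trace is the sum of
    the squared lengths of G^k e_i. The maximising pair depends on G, so its power is bounded by the
    sum over all pairs, which can be averaged over a random G. *)
Lemma trace_le_net (G : 'M[R]_r) k : G^T = G -> 
  (4 * r)%:R ^+ k.*2 * \tr (G ^+ k.*2) <=
  r%:R * \sum_(p | in_net p.1 && in_net p.2) bil G (zval p.1) (zval p.2) ^+ k.*2.
Proof.
move=> sG.
pose N := fun p : {ffun 'I_r -> code} * {ffun 'I_r -> code} => in_net p.1 && in_net p.2.
pose b := fun p : {ffun 'I_r -> code} * {ffun 'I_r -> code} => bil G (zval p.1) (zval p.2).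
(* The zero point lies in the net and gives the value 0, so the maximum is nonnegative. *)
pose o : {ffun 'I_r -> code} := [ffun => (false, ord0)].
have No : N (o, o) by rewrite /N /= /in_net big1 // => i _; rewrite ffunE.
have [q Nq qmax] := Order.TotalTheory.arg_maxP b No.
have bo : b (o, o) = 0.
  rewrite /b /bil big1 // => i _; rewrite big1 // => j _.
  by rewrite /zval ffunE /cval /= mulr0 !mul0r.
have B0 : 0 <= b q by rewrite -bo; exact: qmax.
have HB : forall z z', in_net z -> in_net z' -> bil G (zval z) (zval z') <= b q.
  by move=> z z' zT zT'; apply: (qmax (z, z')); rewrite /N /= zT.
have H := nrm2_mulmx_le sG B0 (bil_le B0 (net_bound sG HB)).
have iter (x : 'cV[R]_r) : (4 * r)%:R ^+ k.*2 * nrm2 (G ^+ k *m x) <= b q ^+ k.*2 * nrm2 x.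
  elim: k => [|j IH]; first by rewrite !expr0 !mul1r mul1mx.
  rewrite doubleS [G ^+ _]exprS -[G * _]/(G *m (G ^+ j)) -mulmxA.
  have e2 (c e y : R) : c * (c * e) * y = c ^+ 2 * (e * y) by ring.
  rewrite !exprS !e2; apply: (@le_trans _ _ ((4 * r)%:R ^+ j.*2 * (b q ^+ 2 * nrm2 (G ^+ j *m x)))).
    by rewrite mulrCA ler_wpM2l ?exprn_ge0.
  by rewrite mulrCA ler_wpM2l ?exprn_ge0 ?sqr_ge0.
have sGk j : (G ^+ j)^T = G ^+ j.
  elim: j => [|j IH]; first by rewrite trmx1.
  by rewrite exprS trmx_mul IH sG -exprS exprSr.
have -> : \tr (G ^+ k.*2) = \sum_i nrm2 (G ^+ k *m delta_mx i 0).
  rewrite -addnn exprD; apply: eq_bigr => i _.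
  rewrite mxE; apply: eq_bigr => j _; rewrite -colE mxE expr2; congr (_ * _).
  by rewrite -{1}sGk mxE.
rewrite [leLHS]mulr_sumr; apply: (@le_trans _ _ (\sum_(i < r) b q ^+ k.*2)).
  apply: ler_sum => i _; apply: le_trans (iter _) _.
  suff -> : nrm2 (delta_mx i 0 : 'cV[R]_r) = 1 by rewrite mulr1.
  rewrite /nrm2 (bigD1 i) //= mxE !eqxx expr1n big1 ?addr0 // => j /negPf ji.
  by rewrite mxE ji expr0n.
rewrite sumr_const card_ord -[leLHS]mulr_natl ler_wpM2l // (bigD1 q) //= lerDl.
apply: sumr_ge0 => p _; rewrite -addnn exprD -expr2; exact: sqr_ge0.
Qed.

End Net.

(** * Doubled walks counted through a random symmetric matrix *)

Section RandomSigns.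
Variables (R : realType) (r : nat).
Hypothesis r0 : (0 < r)%N.
Implicit Type g : {ffun {set 'I_r} -> 'I_3}.

Definition rmx g : 'M[R]_r := \matrix_(i, j) val3 R (g [set i; j]).

Lemma rmx_sym g : (rmx g)^T = rmx g.
Proof. by apply/matrixP => i j; rewrite !mxE finset.setUC. Qed.

Definition coef (x y : 'I_r -> R) (e : {set 'I_r}) : R :=
  \sum_(q : 'I_r * 'I_r | [set q.1; q.2] == e) x q.1 * y q.2.

Lemma bil_rmx g x y : bil (rmx g) x y = \sum_e coef x y e * val3 R (g e).
Proof.
rewrite /bil pair_bigA /= (partition_big (fun q : 'I_r * 'I_r => [set q.1; q.2]) predT) //=.
apply: eq_bigr => e _; rewrite /coef mulr_suml; apply: eq_bigr => q /eqP qe.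
by rewrite mxE qe; ring.
Qed.

(** At most two ordered pairs have the same underlying set, and (a + b)^2 <= 2 (a^2 + b^2). *)
Lemma sum_coef_sqr x y : \sum_e coef x y e ^+ 2 <= 2 * (sqn x * sqn y).
Proof.
have -> : sqn x * sqn y = \sum_e \sum_(q : 'I_r * 'I_r | [set q.1; q.2] == e) (x q.1 * y q.2) ^+ 2.
  rewrite /sqn big_distrlr /= pair_bigA /=.
  rewrite (partition_big (fun q : 'I_r * 'I_r => [set q.1; q.2]) predT) //=.
  by apply: eq_bigr => e _; apply: eq_bigr => q _; rewrite exprMn.
rewrite mulr_sumr; apply: ler_sum => e _; rewrite /coef.
set F := fun q : 'I_r * 'I_r => x q.1 * y q.2.
have [[i j] /= ije|none] := pickP (fun q : 'I_r * 'I_r => [set q.1; q.2] == e); last first.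
  by rewrite !big_pred0 // expr0n mulr0.
have fib (q : 'I_r * 'I_r) : ([set q.1; q.2] == e) = (q == (i, j)) || (q == (j, i)).
  case: q => a b /=; rewrite -(eqP ije) !xpair_eqE; apply/eqP/idP.
    move=> H; have : a \in [set i; j] by rewrite -H set21.
    have : b \in [set i; j] by rewrite -H set22.
    have : i \in [set a; b] by rewrite H set21.
    have : j \in [set a; b] by rewrite H set22.
    rewrite !inE => /orP [] /eqP ? /orP [] /eqP ? /orP [] /eqP ? /orP [] /eqP ?; subst;
      by rewrite !eqxx ?orbT.
  by move=> /orP [] /andP [/eqP -> /eqP ->] //; rewrite finset.setUC.
rewrite !(eq_bigl _ _ fib).
have [ij|ij] := eqVneq i j.
  have E q : (q == (i, j)) || (q == (j, i)) = (q == (i, j)) by rewrite ij orbb.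
  by rewrite !(big_pred1 (i, j)) //= -/(F (i, j)); have := sqr_ge0 (F (i, j)); lra.
have E (f : 'I_r * 'I_r -> R) : \sum_(q | (q == (i, j)) || (q == (j, i))) f q = f (i, j) + f (j, i).
  rewrite (bigD1 (i, j)) ?eqxx //= (big_pred1 (j, i)) // => q /=.
  have [->|qi] := eqVneq q (i, j); last by rewrite /= andbT.
  by rewrite /= xpair_eqE eq_sym [j == _]eq_sym (negPf ij).
by rewrite !E /=; have := sqr_ge0 (x i * y j - x j * y i); rewrite !expr2; nra.
Qed.

(* The exponent is [22 + 8 * 162]: two nets of [2 ^ (11 r)] points each, and
   the exponential moment at [t ^ 2 = 1 / r]. *)
Lemma doubled_walks_le k : (k.*2 <= r)%N ->
  (doubled_walks k.*2 'I_r)%:R <= 2 * r%:R * r%:R ^+ k * expR (1318 * r%:R) :> R.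
Proof.
move=> kr.
set N3 := (3 : R) ^+ #|{: {set 'I_r}}|.
have N30 : 0 < N3 by rewrite exprn_gt0.
have rp : (0 : R) < r%:R by rewrite ltr0n.
have r4 : (0 : R) < (4 * r)%:R by rewrite ltr0n muln_gt0.
(* [N3] is the number of outcomes, so this says that the mean trace is at least the number of
   doubled walks. *)
have H1 : N3 * (doubled_walks k.*2 'I_r)%:R <= \sum_(g : {ffun {set 'I_r} -> 'I_3}) \tr (rmx g ^+ k.*2).
  have -> : \sum_(g : {ffun {set 'I_r} -> 'I_3}) \tr (rmx g ^+ k.*2) = \sum_(t : k.*2.+1.-tuple 'I_r)
     (last (thead t) t == thead t)%:R * \sum_(g : {ffun {set 'I_r} -> 'I_3}) \prod_(e <- steps (thead t) (behead t)) val3 R (g e).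
    rewrite (eq_bigr (fun g => \sum_(t : k.*2.+1.-tuple 'I_r) (last (thead t) t == thead t)%:R *
       \prod_(e <- steps (thead t) (behead t)) val3 R (g e))).
      by rewrite exchange_big /=; apply: eq_bigr => t _; rewrite mulr_sumr.
    move=> g _; rewrite (trace_expmx_walks (fun e => val3 R (g e))) sum_tuple_cons.
    by apply: eq_bigr => x _; apply: eq_bigr => s _; rewrite theadE.
  rewrite /doubled_walks -sum1_card natr_sum mulr_sumr big_mkcond /=; apply: ler_sum => t _.
  rewrite inE /closed_doubled; case: (last _ _ == _); rewrite /= ?mul0r // mul1r.
  have := sum_prod_val3 R (steps (thead t) (behead t)); rewrite -/N3.
  case: (doubled _) => //=; rewrite ?mulr1 //; rewrite mulr0; exact.
pose t0 : R := Num.sqrt r%:R^-1.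
have t00 : 0 < t0 by rewrite sqrtr_gt0 invr_gt0.
have t0E : t0 ^+ 2 = r%:R^-1 by rewrite sqr_sqrtr // invr_ge0 ltW.
have t0k : t0 ^+ k.*2 = (r%:R ^+ k)^-1 by rewrite -mul2n exprM t0E exprVn.
pose M : R := 2 * (k.*2)`!%:R * expR (1296 * r%:R) * r%:R ^+ k.
have H2 z z' : in_net z -> in_net z' ->
    \sum_(g : {ffun {set 'I_r} -> 'I_3}) bil (rmx g) (zval R z) (zval R z') ^+ k.*2 <= N3 * M.
  move=> zT zT'.
  (* Two net points give 2 (9r)^2 = 162 r^2. At t^2 = 1/r the exponent 8 t^2 times 162 r^2 is 1296
     r, linear in r like the logarithm of the size of the net. *)
  have cB : \sum_e coef (zval R z) (zval R z') e ^+ 2 <= 162 * r%:R ^+ 2.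
    apply: le_trans (sum_coef_sqr _ _) _.
    have := sqn_in_net R zT; have := sqn_in_net R zT'; rewrite !natrM.
    have := sqn_ge0 (zval R z); have := sqn_ge0 (zval R z').
    set a := sqn _; set b := sqn _ => a0 b0 a9 b9.
    have : b * a <= (9%:R * r%:R) * (9%:R * r%:R) by apply: ler_pM.
    rewrite expr2; lra.
  have := sum_pow_val3 k t00 cB.
  rewrite t0k invrK t0E (_ : 8 * r%:R^-1 * (162 * r%:R ^+ 2) = 1296 * r%:R); last first.
    by field; rewrite gt_eqF.
  rewrite -/N3 => H; under eq_bigr do rewrite bil_rmx.
  by apply: le_trans H _; rewrite /M !mulrA.
have H3 : (4 * r)%:R ^+ k.*2 * \sum_(g : {ffun {set 'I_r} -> 'I_3}) \tr (rmx g ^+ k.*2) <=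
    r%:R * (2 ^+ (11 * r) * 2 ^+ (11 * r) * (N3 * M)).
  rewrite [leLHS]mulr_sumr; apply: (@le_trans _ _ (\sum_(g : {ffun {set 'I_r} -> 'I_3}) r%:R *
     \sum_(p : {ffun 'I_r -> code r} * {ffun 'I_r -> code r} | in_net p.1 && in_net p.2)
        bil (rmx g) (zval R p.1) (zval R p.2) ^+ k.*2)).
    by apply: ler_sum => g _; exact: trace_le_net (rmx_sym g).
  rewrite -mulr_sumr ler_wpM2l // exchange_big /=.
  apply: (@le_trans _ _ (\sum_(p : {ffun 'I_r -> code r} * {ffun 'I_r -> code r} |
      in_net p.1 && in_net p.2) N3 * M)).
    by apply: ler_sum => p /andP [p1 p2]; exact: H2.
  have M0 : 0 <= N3 * M.
    by rewrite mulr_ge0 ?(ltW N30) // /M !mulr_ge0 ?expR_ge0 ?exprn_ge0.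
  rewrite -(pair_big (@in_net r) (@in_net r) (fun _ _ => N3 * M)) /=.
  have -> : \sum_(i : {ffun 'I_r -> code r} | in_net i) \sum_(j : {ffun 'I_r -> code r} | in_net j) N3 * M =
     (\sum_(i : {ffun 'I_r -> code r} | in_net i) 1) * (\sum_(j : {ffun 'I_r -> code r} | in_net j) 1) * (N3 * M).
    have cst (c : R) : \sum_(i : {ffun 'I_r -> code r} | in_net i) c =
        (\sum_(i : {ffun 'I_r -> code r} | in_net i) 1) * c.
      by rewrite [RHS]mulr_suml; apply: eq_bigr => i _; rewrite mul1r.
    by rewrite cst (cst (N3 * M)) mulrA.
  rewrite ler_wpM2r // ler_pM ?sumr_ge0 //; exact: card_net.
have H4 : (4 * r)%:R ^+ k.*2 * (doubled_walks k.*2 'I_r)%:R <=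
    r%:R * (2 ^+ (11 * r) * 2 ^+ (11 * r) * M).
  rewrite -(ler_pM2l N30) mulrCA.
  have := ler_wpM2l (exprn_ge0 k.*2 (ltW r4)) H1 => /le_trans /(_ H3).
  by move=> /le_trans; apply; rewrite le_eqVlt; apply/orP; left; apply/eqP; ring.
(* Here 2k <= r enters: the factorial is absorbed by the scaling factor of [trace_le_net]. *)
have fk : (k.*2)`!%:R <= (4 * r)%:R ^+ k.*2 :> R.
  apply: (@le_trans _ _ (k.*2 ^ k.*2)%:R).
    by rewrite ler_nat -ffactnn ffact_le_expn.
  by rewrite natrX lerXn2r ?nnegrE // ler_nat (leq_trans kr) // leq_pmull.
have e22 : (2 : R) ^+ (11 * r) * 2 ^+ (11 * r) <= expR (22 * r%:R).
  rewrite -exprD (_ : 11 * r + 11 * r = 22 * r)%N; last by ring.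
  have e2 : (2 : R) <= expR 1 by have := expR_ge1Dx (1 : R); lra.
  apply: (@le_trans _ _ (expR 1 ^+ (22 * r))); first by rewrite lerXn2r // nnegrE ?expR_ge0.
  by rewrite -expRM_natl mulr1 natrM.
rewrite -(ler_pM2l (exprn_gt0 k.*2 r4)); apply: le_trans H4 _.
rewrite (_ : 1318 * r%:R = 22 * r%:R + 1296 * r%:R) ?expRD; last by ring.
rewrite /M.
have -> : r%:R * (2 ^+ (11 * r) * 2 ^+ (11 * r) *
   (2 * (k.*2)`!%:R * expR (1296 * r%:R) * r%:R ^+ k)) =
   (2 ^+ (11 * r) * 2 ^+ (11 * r)) * (k.*2)`!%:R * (2 * r%:R * r%:R ^+ k * expR (1296 * r%:R)) :> R by ring.
have -> : (4 * r)%:R ^+ k.*2 * (2 * r%:R * r%:R ^+ k * (expR (22 * r%:R) * expR (1296 * r%:R))) =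
   expR (22 * r%:R) * (4 * r)%:R ^+ k.*2 * (2 * r%:R * r%:R ^+ k * expR (1296 * r%:R)) :> R by ring.
rewrite ler_wpM2r ?mulr_ge0 ?exprn_ge0 ?expR_ge0 //.
by rewrite ler_pM ?mulr_ge0 ?exprn_ge0.
Qed.

End RandomSigns.

(** * Centred link matrices *)

Section Bernoulli.
Variables (R : realType) (T : finType) (S : {set T}) (p : R).
Hypothesis p01 : 0 <= p <= 1.

Definition wt (F : {set T}) : R := \prod_(s in S) (if s \in F then p else 1 - p).
Definition expect (X : {set T} -> R) : R := \sum_(F : {set T} | F \subset S) wt F * X F.

Lemma wt_ge0 F : 0 <= wt F.
Proof. by apply: prodr_ge0 => s _; case/andP: p01 => p0 p1; case: ifP => _ //; rewrite subr_ge0. Qed.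

Lemma expect_prod (h : T -> bool -> R) :
  expect (fun F => \prod_(s in S) h s (s \in F)) =
  \prod_(s in S) (p * h s true + (1 - p) * h s false).
Proof.
(* The values 0 and 1 outside [S] leave only the subsets of [S] when the product of sums is
   expanded. *)
pose f s := if s \in S then p * h s true else 0.
pose g s := if s \in S then (1 - p) * h s false else 1.
transitivity (\prod_s (f s + g s)); last first.
  rewrite [RHS]big_mkcond; apply: eq_bigr => s _; rewrite /f /g.
  by case: ifP => //; rewrite add0r.
rewrite bigA_distr /expect big_mkcond /=; apply: eq_bigr => F _.
case: ifP => [FS|/negbT /subsetPn [s sF sS]]; last first.
  by rewrite (bigD1 s) //= sF /f (negPf sS) mul0r.
rewrite /wt -big_split /= big_mkcond; apply: eq_bigr => s _; rewrite /f /g.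
have [sS|sS] := boolP (s \in S); first by case: ifP.
by rewrite (contraNF (fintype.subsetP FS s) sS).
Qed.

Lemma expect_cst c : expect (fun=> c) = c.
Proof.
rewrite /expect -mulr_suml -[RHS]mul1r; congr (_ * _).
transitivity (expect (fun F => \prod_(s in S) 1)).
  by apply: eq_bigr => F _; rewrite big1 // mulr1.
rewrite (expect_prod (fun _ _ => 1)) big1 // => s _; ring.
Qed.

Lemma expect_sum (I : Type) (r : seq I) (P : pred I) (X : I -> {set T} -> R) :
  expect (fun F => \sum_(i <- r | P i) X i F) = \sum_(i <- r | P i) expect (X i).
Proof.
rewrite /expect exchange_big /=; apply: eq_bigr => F _; exact: mulr_sumr.
Qed.

Lemma expectZ c X : expect (fun F => c * X F) = c * expect X.
Proof. by rewrite /expect mulr_sumr; apply: eq_bigr => F _; rewrite mulrCA. Qed.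

(** For c >= 2 the two terms are at most p (1 - p) and (1 - p) p^2, whose sum is p - p^3. *)
Lemma centred_moment c : `|p * (1 - p) ^+ c + (1 - p) * (- p) ^+ c| <=
  if c == 0 then 1 else if c == 1 then 0 else p.
Proof.
have /andP [p0 p1] := p01.
case: c => [|[|c]]; rewrite [leRHS]/=.
- by rewrite !expr0 !mulr1 ler_norml; apply/andP; split; lra.
- by rewrite !expr1 ler_norml; apply/andP; split; nra.
have q0 : 0 <= 1 - p by lra.
apply: le_trans (ler_normD _ _) _.
rewrite (normrM p) (normrM (1 - p) ((- p) ^+ _)) !normrX normrN !ger0_norm //.
have q1 : 1 - p <= 1 by lra.
have h1 : (1 - p) ^+ c.+2 <= 1 - p by rewrite exprS ler_piMr // exprn_ile1.
have h2 : p ^+ c.+2 <= p * p by rewrite exprS ler_wpM2l // exprS ler_piMr // exprn_ile1.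
have h3 : 0 <= p * (p * p) by rewrite !mulr_ge0.
have := ler_wpM2l p0 h1; have := ler_wpM2l q0 h2.
rewrite [p * (1 - p)]mulrBr [(1 - p) * (p * p)]mulrBl; lra.
Qed.

(** By independence an element that occurs exactly once makes the mean vanish; every other distinct
    element contributes at most p. *)
Lemma expect_centred (es : seq T) : {subset es <= S} ->
  `|expect (fun F => \prod_(e <- es) ((e \in F)%:R - p))| <=
  (doubled es)%:R * p ^+ size (undup es).
Proof.
move=> esS; have /andP [p0 p1] := p01.
have -> : expect (fun F => \prod_(e <- es) ((e \in F)%:R - p)) =
   expect (fun F => \prod_(e in S) ((e \in F)%:R - p) ^+ count_mem e es).
  apply: eq_bigr => F _; congr (_ * _).
  rewrite prod_count [RHS]big_mkcond; apply: eq_bigr => e _.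
  case: ifP => // /negbT eS; rewrite (count_memPn _) ?expr0 //.
  by apply: contra eS; exact: esS.
rewrite (expect_prod (fun e b => (b%:R - p) ^+ count_mem e es)) normr_prod.
rewrite /= sub0r.
have [de|/allPn [e ee]] := boolP (doubled es); last first.
  rewrite -leqNgt => c1; rewrite mul0r (bigD1 e) ?esS //=.
  have c0 : count_mem e es != 0%N by rewrite -lt0n -has_count has_pred1.
  have := centred_moment (count_mem e es); rewrite (negPf c0).
  have -> : count_mem e es == 1%N by rewrite eqn_leq c1 lt0n c0.
  by rewrite normr_le0 => /eqP ->; rewrite normr0 mul0r.
rewrite mul1r; have -> : p ^+ size (undup es) = \prod_(e in S) (if e \in es then p else 1).
  rewrite -big_mkcondr /= prodr_const; congr (_ ^+ _).
  rewrite -(card_uniqP (undup_uniq es)); apply: eq_card => e.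
  by rewrite mem_undup [RHS]unfold_in; apply/esym/andb_idl; exact: esS.
apply: ler_prod => e eS; rewrite normr_ge0 /=.
apply: le_trans (centred_moment _) _.
have [ein|eout] := boolP (e \in es); last by rewrite (count_memPn eout).
have := allP de _ ein; by case: (count_mem e es) => [|[|c]].
Qed.

End Bernoulli.

(** * Trace moments of the link matrices *)

Section LinkMatrix.
Variables (R : realType) (n d : nat) (p : R).
Hypothesis p01 : 0 <= p <= 1.
Implicit Types (F : {set {set 'I_n}}) (rho e : {set 'I_n}).
Local Notation S := (subsets_of_card n d.+1).

(** The cardinality condition makes the diagonal of [link_mx] zero, and disjointness extends the
    matrix by zero to the vertices of [rho]. *)
Definition link_edge rho e : bool := (#|e| == 2)%N && [disjoint e & rho].
Definition link_var rho F e : R :=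
  if link_edge rho e then ((rho :|: e)%SET \in F)%:R - p else 0.
Definition link_mx rho F : 'M[R]_n := \matrix_(u, v) link_var rho F [set u; v]%SET.

Lemma link_mx_sym rho F : (link_mx rho F)^T = link_mx rho F.
Proof. by apply/matrixP => i j; rewrite !mxE finset.setUC. Qed.

(** Different edges of a link come from different (d+1)-sets, which gives the independence of the
    entries up to symmetry. *)
Lemma link_edge_inj rho e e' : link_edge rho e -> link_edge rho e' ->
  (rho :|: e = rho :|: e')%SET -> e = e'.
Proof.
move=> /andP [_ de] /andP [_ de'] H.
have E (f : {set 'I_n}) : [disjoint f & rho] -> f = ((rho :|: f) :\: rho)%SET.
  move=> df; apply/setP => x; rewrite !inE; have [xr|] /= := boolP (x \in rho).
    by rewrite (disjointFl df xr).
  by [].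
by rewrite (E e de) (E e' de') H.
Qed.

Lemma count_map_in (T U : eqType) (h : T -> U) (s : seq T) (e : T) :
  {in s &, injective h} -> e \in s -> count_mem (h e) (map h s) = count_mem e s.
Proof.
move=> hi es; rewrite count_map; apply: eq_in_count => f fs /=.
by apply/eqP/eqP => [/hi ->|->].
Qed.

Lemma doubled_map_in (T U : eqType) (h : T -> U) (s : seq T) :
  {in s &, injective h} -> doubled (map h s) = doubled s.
Proof.
move=> hi; rewrite /doubled all_map; apply: eq_in_all => e es /=.
by rewrite count_map_in.
Qed.

Lemma size_undup_map_in (T U : eqType) (h : T -> U) (s : seq T) :
  {in s &, injective h} -> size (undup (map h s)) = size (undup s).
Proof.
move=> hi.
have : undup (map h s) =i map h (undup s).
  by move=> y; rewrite mem_undup; apply/mapP/mapP => -[x xs ->]; exists x; rewrite ?mem_undup // -mem_undup.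
move=> /(uniq_perm (undup_uniq _)) H; rewrite -(size_map h (undup s)); apply: perm_size.
by apply: H; rewrite map_inj_in_uniq ?undup_uniq // => x y; rewrite !mem_undup; exact: hi.
Qed.

Lemma expect_link_prod rho (es : seq {set 'I_n}) : #|rho|.+1 = d ->
  `|expect S p (fun F => \prod_(e <- es) link_var rho F e)| <=
  (doubled es)%:R * p ^+ size (undup es).
Proof.
move=> rd; have /andP [p0 _] := p01.
have [/allP ok|/allPn [e ee nok]] := boolP (all (link_edge rho) es); last first.
  rewrite /expect big1 ?normr0 ?mulr_ge0 ?exprn_ge0 // => F _.
  by rewrite (big_rem e) //= /link_var (negPf nok) mul0r mulr0.
pose h e := (rho :|: e)%SET.
have hi : {in es &, injective h}.
  by move=> e e' /ok o /ok o'; exact: link_edge_inj o o'.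
have -> : expect S p (fun F => \prod_(e <- es) link_var rho F e) =
    expect S p (fun F => \prod_(e <- map h es) ((e \in F)%:R - p)).
  apply: eq_bigr => F _; congr (_ * _); rewrite big_map big_seq [RHS]big_seq.
  by apply: eq_bigr => e /ok oe; rewrite /link_var oe.
rewrite -(doubled_map_in hi) -(size_undup_map_in hi); apply: expect_centred => // t.
move=> /mapP [e /ok /andP [/eqP e2 de] ->].
by rewrite inE cardsU disjoint_setI0 1?disjoint_sym // cards0 subn0 e2 addn2 -rd.
Qed.

Lemma expect_link_trace rho m r : #|rho|.+1 = d -> n%:R * p + m%:R <= r%:R -> (m < r)%N ->
  expect S p (fun F => \tr (link_mx rho F ^+ m)) <= n%:R * (doubled_walks m 'I_r)%:R.
Proof.
move=> rd nr mr; have /andP [p0 p1] := p01.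
apply: le_trans (doubled_walks_compare p0 nr mr).
have -> : expect S p (fun F => \tr (link_mx rho F ^+ m)) =
   \sum_(t : m.+1.-tuple 'I_n) (last (thead t) t == thead t)%:R *
      expect S p (fun F => \prod_(e <- steps (thead t) (behead t)) link_var rho F e).
  under [RHS]eq_bigr do rewrite -expectZ.
  rewrite -expect_sum; apply: eq_bigr => F _; congr (_ * _).
  rewrite (trace_expmx_walks (link_var rho F)) sum_tuple_cons.
  by apply: eq_bigr => x _; apply: eq_bigr => s _; rewrite theadE.
rewrite [leRHS]big_mkcond /=; apply: ler_sum => t _; rewrite /closed_doubled.
case: (last _ _ == _); rewrite /= ?mul0r // mul1r.
have := expect_link_prod (steps (thead t) (behead t)) rd => H.
apply: le_trans (ler_norm _) (le_trans H _).
case: (doubled _); rewrite /= ?mul0r // mul1r.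
(* As p <= 1, it suffices that a walk with v vertices has at least v - 1 distinct edges. *)
rewrite ler_wiXn2l //.
have := card_vertices_steps (thead t) (behead t).
have -> : [set y in thead t :: behead t]%SET = [set x in t]%SET.
  by rewrite [in RHS](tuple_eta t).
by case: #|_|.
Qed.

End LinkMatrix.

(** * Forms on ordered faces *)

Section Tuples.
Variables (T : finType).

Definition del k (i : 'I_k.+1) (t : k.+1.-tuple T) : k.-tuple T :=
  [tuple tnth t (lift i m) | m < k].
Definition ins k (i : 'I_k.+1) (v : T) (t : k.-tuple T) : k.+1.-tuple T :=
  [tuple oapp (tnth t) v (unlift i m) | m < k.+1].
Definition perm_tuple k (s : 'S_k) (t : k.-tuple T) : k.-tuple T :=
  [tuple tnth t (s i) | i < k].

Lemma tnth_cons0 k v (t : k.-tuple T) : tnth [tuple of v :: t] ord0 = v.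
Proof. by []. Qed.

Lemma tnth_cons_lift k v (t : k.-tuple T) i : tnth [tuple of v :: t] (lift ord0 i) = tnth t i.
Proof. by rewrite !(tnth_nth v). Qed.

Lemma tuple_consP k v (t : k.-tuple T) (u : k.+1.-tuple T) :
  tnth u ord0 = v -> (forall i, tnth u (lift ord0 i) = tnth t i) -> u = [tuple of v :: t].
Proof.
move=> h0 h; apply: eq_from_tnth => m; case: (unliftP ord0 m) => [m'|] ->.
  by rewrite h tnth_cons_lift.
by rewrite h0.
Qed.

Lemma sum_tuple_at (R : nmodType) k (i : 'I_k.+1) (phi : T -> k.-tuple T -> R) :
  \sum_(t : k.+1.-tuple T) phi (tnth t i) (del i t) = \sum_v \sum_t phi v t.
Proof.
rewrite pair_bigA /= (reindex (fun q : T * k.-tuple T => ins i q.1 q.2)) /=.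
  apply: eq_bigr => -[v t] _ /=; congr (phi _ _).
    by rewrite tnth_mktuple unlift_none.
  by apply: eq_from_tnth => m; rewrite !tnth_mktuple liftK.
exists (fun t : k.+1.-tuple T => (tnth t i, del i t)) => [[v t] _|t _] /=.
  congr pair; first by rewrite tnth_mktuple unlift_none.
  by apply: eq_from_tnth => m; rewrite !tnth_mktuple liftK.
apply: eq_from_tnth => m; rewrite tnth_mktuple; case: unliftP => [m'|] -> //=.
by rewrite tnth_mktuple.
Qed.

(** [lift_perm ord0 i 1] is the cycle bringing position [i] to the front; its signature is the sign
    (-1)^i of the coboundary. *)
Lemma front_perm k (i : 'I_k.+1) (t : k.+1.-tuple T) :
  perm_tuple (lift_perm ord0 i 1) t = [tuple of tnth t i :: del i t].
Proof.
apply: tuple_consP => [|m]; rewrite tnth_mktuple ?lift_perm_id //.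
by rewrite lift_perm_lift perm1 tnth_mktuple.
Qed.

Lemma mem_perm_tuple k (s : 'S_k) (t : k.-tuple T) : perm_tuple s t =i t.
Proof.
move=> x; apply/tnthP/tnthP => -[i ->]; first by exists (s i); rewrite tnth_mktuple.
by exists (s^-1%g i); rewrite tnth_mktuple permKV.
Qed.

Lemma uniq_perm_tuple k (s : 'S_k) (t : k.-tuple T) : uniq (perm_tuple s t) = uniq t.
Proof. by apply: eq_uniq; rewrite ?size_tuple //; exact: mem_perm_tuple. Qed.

Lemma del_cons0 k v (t : k.-tuple T) : del ord0 [tuple of v :: t] = t.
Proof. by apply: eq_from_tnth => m; rewrite tnth_mktuple tnth_cons_lift. Qed.

Lemma lift_lift0 k (i : 'I_k.+1) (m : 'I_k) : lift (lift ord0 i) (lift ord0 m) = lift ord0 (lift i m).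
Proof. by apply: val_inj => /=; rewrite /bump /= !add1n ltnS addnS. Qed.

Lemma del_cons_lift k v (i : 'I_k.+1) (t : k.+1.-tuple T) :
  del (lift ord0 i) [tuple of v :: t] = [tuple of v :: del i t].
Proof.
apply: tuple_consP => [|m]; rewrite tnth_mktuple.
  by rewrite (_ : lift (lift ord0 i) ord0 = ord0) //; apply: val_inj.
by rewrite lift_lift0 tnth_cons_lift tnth_mktuple.
Qed.

(** Deleting an entry after a permutation is a permutation of the tuple with entry [s i] deleted;
    the parities account for the signs that make the coboundary of a form a form. *)
Lemma perm_tuple_lift k (i : 'I_k.+1) (s : 'S_k.+1) (t : k.+1.-tuple T) :
  exists2 s' : 'S_k, odd_perm s = odd i (+) odd (s i) (+) odd_perm s' &
    del i (perm_tuple s t) = perm_tuple s' (del (s i) t).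
Proof.
have ne m : s i != s (lift i m).
  by rewrite (inj_eq perm_inj) neq_lift.
have ex m : {m' : 'I_k | s (lift i m) = lift (s i) m'}.
  by case: (unlift_some (ne m)) => m' -> _; exists m'.
pose h m := sval (ex m).
have hE m : s (lift i m) = lift (s i) (h m) by rewrite /h; case: (ex m).
have hi : injective h.
  by move=> a b ab; apply: (@lift_inj _ i); apply: (@perm_inj _ s); rewrite !hE ab.
exists (perm hi).
  rewrite -[in LHS](_ : lift_perm i (s i) (perm hi) = s) ?odd_lift_perm //.
  apply/permP => m; case: (unliftP i m) => [m'|] ->; last by rewrite lift_perm_id.
  by rewrite lift_perm_lift permE hE.
by apply: eq_from_tnth => m; rewrite !tnth_mktuple permE hE.
Qed.

Lemma set_cons k v (t : k.-tuple T) : [set x in [tuple of v :: t]]%SET = (v |: [set x in t])%SET.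
Proof. by apply/setP => x; rewrite !inE. Qed.

Lemma uniq_card k (t : k.-tuple T) : uniq t -> #|[set x in t]%SET| = k.
Proof. by move=> ut; rewrite cardsE (card_uniqP ut) size_tuple. Qed.

End Tuples.

Section Complex.
Variables (R : realType) (n j : nat) (F : {set {set 'I_n}}).
Local Notation d := j.+1.
Local Notation Y := (complex_of d F).

(** The complex has a complete (d-1)-skeleton. *)
Lemma ordering_low k (t : k.-tuple 'I_n) : (k <= d)%N -> ordering Y t = uniq t.
Proof.
move=> kd; rewrite /ordering; have [ut|] //= := boolP (uniq t).
by rewrite !inE uniq_card // kd.
Qed.

Lemma ordering_top (t : d.+1.-tuple 'I_n) : ordering Y t = uniq t && ([set x in t]%SET \in F).
Proof.
rewrite /ordering; have [ut|] //= := boolP (uniq t).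
by rewrite !inE uniq_card // ltnn.
Qed.

Lemma ordering_perm k (s : 'S_k) (t : k.-tuple 'I_n) : ordering Y (perm_tuple s t) = ordering Y t.
Proof.
rewrite /ordering uniq_perm_tuple (_ : [set x in perm_tuple s t]%SET = [set x in t]%SET) //.
by apply/setP => x; rewrite !inE mem_perm_tuple.
Qed.

Lemma skew_front k (f : {ffun k.+1.-tuple 'I_n -> R}) (i : 'I_k.+1) t : forms Y f ->
  f [tuple of tnth t i :: del i t] = (-1) ^+ i * f t.
Proof.
by move=> [_ skew]; rewrite -front_perm skew odd_lift_perm odd_perm1 addbF /= signr_odd.
Qed.

Lemma boundaryE k (g : {ffun k.+1.-tuple 'I_n -> R}) t : (k <= d)%N -> forms Y g ->
  boundary Y g t = \sum_v g [tuple of v :: t].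
Proof.
move=> kd [g0 _]; rewrite ffunE ordering_low //.
have [ut|nut] := ifPn; last first.
  by rewrite big1 // => v _; rewrite g0 // /ordering /= (negPf nut) andbF.
rewrite big_mkcond; apply: eq_bigr => v _; case: ifPn => // nv.
rewrite g0 //; apply: contra nv => /andP [uvt vY].
by rewrite inE -set_cons vY; apply/eqP; exact: (uniq_card uvt).
Qed.

Lemma boundary_forms k (g : {ffun k.+1.-tuple 'I_n -> R}) : (k <= d)%N -> forms Y g ->
  forms Y (boundary Y g).
Proof.
move=> kd fg; split=> [t|t s]; first by rewrite ffunE => /negPf ->.
rewrite !boundaryE // mulr_sumr; apply: eq_bigr => v _.
have -> : [tuple of v :: [tuple tnth t (s i) | i < k]] =
    perm_tuple (lift_perm ord0 ord0 s) [tuple of v :: t].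
  apply/esym/tuple_consP => [|m]; rewrite tnth_mktuple ?lift_perm_id //.
  by rewrite lift_perm_lift tnth_cons_lift tnth_mktuple.
by case: fg => _ ->; rewrite odd_lift_perm.
Qed.

(** Exchanging the two added vertices changes the sign, so the double sum equals its own
    opposite. *)
Lemma boundary_boundary k (g : {ffun k.+2.-tuple 'I_n -> R}) : (k < d)%N -> forms Y g ->
  boundary Y (boundary Y g) = 0.
Proof.
move=> kd fg; apply/ffunP => t; rewrite boundaryE ?(ltnW kd) //; last exact: (boundary_forms kd fg).
under eq_bigr do rewrite boundaryE //.
rewrite ffunE; set a := LHS.
suff : a = - a.
  by move=> /eqP; rewrite -subr_eq0 opprK -mulr2n -mulr_natl mulf_eq0 pnatr_eq0 => /eqP.
have swap v w : g [tuple of w :: [tuple of v :: t]] = - g [tuple of v :: [tuple of w :: t]].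
  rewrite -mulN1r -[-1]expr1; apply: etrans (skew_front (lift ord0 ord0) [tuple of v :: [tuple of w :: t]] fg).
  congr (g _); apply/esym/tuple_consP => [|m]; first by [].
  by rewrite tnth_cons_lift del_cons_lift del_cons0.
rewrite {1}/a exchange_big /a -sumrN; apply: eq_bigr => v _; rewrite -sumrN.
by apply: eq_bigr => w _; exact: swap.
Qed.

Lemma coboundary_forms (f : {ffun d.-tuple 'I_n -> R}) : forms Y f -> forms Y (coboundary Y f).
Proof.
move=> ff; split=> [t|t s]; first by rewrite ffunE => /negPf ->.
rewrite !ffunE -[mktuple _]/(perm_tuple s t) ordering_perm; case: ifP => // _; last by rewrite mulr0.
rewrite mulr_sumr [RHS](reindex_inj (h := s)) /=; last exact: perm_inj.
apply: eq_bigr => i _; have [s' os E] := perm_tuple_lift i s t.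
have [_ skew] := ff.
rewrite -[mktuple _]/(del i (perm_tuple s t)) -[X in _ = _ * (_ * f X)]/(del (s i) t) E.
rewrite /perm_tuple skew !mulrA; congr (_ * _).
rewrite os 2!signr_addb !signr_odd; set x := (-1) ^+ (s i).
have x2 : x * x = 1 by rewrite /x -expr2 sqrr_sign.
by move: x x2 ((-1) ^+ i : R) ((-1) ^+ s' : R) => x x2 a b; rewrite -[LHS]mulr1 -x2; ring.
Qed.

(** The sums run over ordered tuples: a d-face is counted (d+1)! times and a (d-1)-face d! times,
    hence the factor d + 1. *)
Lemma adjoint (f : {ffun d.-tuple 'I_n -> R}) (g : {ffun d.+1.-tuple 'I_n -> R}) : forms Y g ->
  \sum_t coboundary Y f t * g t = d.+1%:R * \sum_t f t * boundary Y g t.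
Proof.
move=> fg; transitivity (\sum_(i < d.+1) \sum_v \sum_t f t * g [tuple of v :: t]).
  rewrite (eq_bigr (fun t => \sum_(i < d.+1) f (del i t) * g [tuple of tnth t i :: del i t])).
    rewrite exchange_big; apply: eq_bigr => i _ /=.
    exact: (sum_tuple_at i (fun v t => f t * g [tuple of v :: t])).
  move=> t _; rewrite ffunE; have [ot|not] := ifPn.
    rewrite mulr_suml; apply: eq_bigr => i _; rewrite skew_front // -/(del i t); ring.
  by rewrite mul0r big1 // => i _; case: (fg) => g0 _; rewrite skew_front // g0 // !mulr0.
rewrite sumr_const card_ord mulr_natl; congr (_ *+ _); rewrite exchange_big /=.
by apply: eq_bigr => t _; rewrite boundaryE // mulr_sumr.
Qed.

Lemma laplacian_form (f h : {ffun d.-tuple 'I_n -> R}) : forms Y h ->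
  d.+1%:R * \sum_t f t * upper_laplacian Y h t = \sum_t coboundary Y f t * coboundary Y h t.
Proof. by move=> fh; rewrite /upper_laplacian adjoint //; exact: coboundary_forms. Qed.

Lemma laplacian_cycles (f : {ffun d.-tuple 'I_n -> R}) : forms Y f -> cycles Y (upper_laplacian Y f).
Proof.
move=> ff; have fc := coboundary_forms ff.
by split; [exact: boundary_forms | exact: boundary_boundary].
Qed.

Lemma coboundary_cons (f : {ffun d.-tuple 'I_n -> R}) (v : 'I_n) (t : d.-tuple 'I_n) :
  coboundary Y f [tuple of v :: t] = (ordering Y [tuple of v :: t])%:R *
    (f t - \sum_(i < d) (-1) ^+ i * f [tuple of v :: del i t]).
Proof.
rewrite ffunE; case: ifP => _; last by rewrite mul0r.
rewrite mul1r big_ord_recl /= expr0 mul1r -/(del _ _) del_cons0 -sumrN; congr (_ + _).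
by apply: eq_bigr => i _; rewrite -/(del _ _) del_cons_lift exprS mulN1r mulNr.
Qed.

End Complex.

(** * Reduction of the lower bound to the links *)

Section LowerBound.
Variables (R : realType) (n j : nat) (F : {set {set 'I_n}}) (p L : R).
Local Notation d := j.+1.
Local Notation Y := (complex_of d F).

Definition nbrs (s : {set 'I_n}) : {set 'I_n} := [set v | (v \notin s) && ((v |: s)%SET \in F)]%SET.

Lemma deg_nbrs (s : {set 'I_n}) : #|s| = d -> deg Y d s = #|nbrs s|.
Proof.
move=> sd; rewrite /deg.
rewrite -(@card_in_imset _ _ (fun v => (v |: s)%SET) (mem (nbrs s))); last first.
  move=> v w; rewrite !inE => /andP [vs _] /andP [ws _] /setP /(_ v).
  by rewrite !inE eqxx /= (negPf vs) orbF => /esym /eqP.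
apply: eq_card => t; rewrite !inE; apply/idP/imsetP => [/andP [/andP [tY /eqP td] st]|[v]].
  have : #|t :\: s|%SET = 1%N by rewrite cardsD (finset.setIidPr st) td sd subSnn.
  move=> /eqP /cards1P [v tv].
  have tE : t = (v |: s)%SET by rewrite -tv finset.setUC -{1}(finset.setIidPr st) finset.setID.
  exists v => //; rewrite !inE -tE; apply/andP; split.
    have : v \in (t :\: s)%SET by rewrite tv inE.
    by rewrite inE => /andP [].
  by move: tY; rewrite td ltnn.
rewrite !inE => /andP [vs vF] ->; rewrite vF orbT cardsU1 vs sd eqxx /=.
exact: finset.subsetUr.
Qed.

Lemma ordering_cons (v : 'I_n) (t : d.-tuple 'I_n) : uniq t ->
  ordering Y [tuple of v :: t] = (v \in nbrs [set x in t]%SET).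
Proof. by move=> ut; rewrite ordering_top /= ut andbT set_cons !inE. Qed.

(** The quadratic form of D - A. In the adjacency part, skew symmetry moves the deleted vertex to
    the front and absorbs its sign; each of the d positions then gives the same sum over ordered
    (d-2)-faces. *)
Lemma laplacian_split (f : {ffun d.-tuple 'I_n -> R}) : forms Y f ->
  \sum_t f t * upper_laplacian Y f t =
  \sum_(t : d.-tuple 'I_n) (deg Y d [set x in t]%SET)%:R * f t ^+ 2 -
  d%:R * \sum_(s : j.-tuple 'I_n) \sum_u \sum_v
     (ordering Y [tuple of v :: [tuple of u :: s]])%:R *
        (f [tuple of u :: s] * f [tuple of v :: s]).
Proof.
move=> ff; have [f0 _] := ff.
have cf := coboundary_forms ff.
have -> : \sum_t f t * upper_laplacian Y f t =
    \sum_(t : d.-tuple 'I_n) (\sum_v (ordering Y [tuple of v :: t])%:R * f t ^+ 2 -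
     \sum_(i < d) \sum_v (ordering Y [tuple of v :: [tuple of tnth t i :: del i t]])%:R *
        (f [tuple of tnth t i :: del i t] * f [tuple of v :: del i t])).
  apply: eq_bigr => t _; rewrite /upper_laplacian boundaryE // mulr_sumr.
  rewrite [X in _ - X]exchange_big /= -sumrB; apply: eq_bigr => v _.
  rewrite coboundary_cons mulrCA mulrBr mulrBr -expr2; congr (_ - _).
  rewrite !mulr_sumr; apply: eq_bigr => i _.
  have -> : ordering Y [tuple of v :: [tuple of tnth t i :: del i t]] = ordering Y [tuple of v :: t].
    rewrite -[RHS](@ordering_perm n j F _ (lift_perm ord0 ord0 (lift_perm ord0 i 1))).
    congr (ordering _ _); apply/esym/tuple_consP => [|m]; rewrite tnth_mktuple ?lift_perm_id //.
    by rewrite lift_perm_lift tnth_cons_lift -front_perm tnth_mktuple.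
  by rewrite (skew_front i t ff); congr (_ * _); rewrite mulrCA mulrA.
rewrite sumrB; congr (_ - _).
  apply: eq_bigr => t _; have [ut|nut] := boolP (uniq t); last first.
    by rewrite f0 ?ordering_low // expr0n /= mulr0 big1 // => v _; rewrite mulr0.
  rewrite -mulr_suml; congr (_ * _); rewrite deg_nbrs ?uniq_card //.
  rewrite -natr_sum; congr (_%:R); rewrite -sum1_card [RHS]big_mkcond /=.
  by apply: eq_bigr => v _; rewrite ordering_cons //; case: (_ \in _).
pose Phi (u : 'I_n) (s : j.-tuple 'I_n) : R :=
  \sum_v (ordering Y [tuple of v :: [tuple of u :: s]])%:R *
     (f [tuple of u :: s] * f [tuple of v :: s]).
transitivity (\sum_(i < d) \sum_s \sum_u Phi u s); last first.
  by rewrite sumr_const card_ord mulr_natl.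
rewrite exchange_big; apply: eq_bigr => i _.
by apply: etrans (sum_tuple_at i Phi) _; rewrite exchange_big.
Qed.

Hypothesis p0 : 0 <= p.
Hypothesis L0 : 0 <= L.
Hypothesis good : forall rho : {set 'I_n}, #|rho|.+1 = d ->
  forall x : 'cV[R]_n, quad (link_mx p rho F) x <= L * nrm2 x.

Lemma quad_sum (M : 'M[R]_n) (x : 'I_n -> R) :
  quad M (\col_u x u) = \sum_u \sum_v x u * M u v * x v.
Proof.
rewrite quadE; apply: eq_bigr => u _; rewrite !mxE mulr_sumr; apply: eq_bigr => v _.
by rewrite mxE mulrA.
Qed.

(* The rank one part of the expected adjacency matrix vanishes on the restriction
   of a cycle to a link, and its diagonal part has the favourable sign. *)
Lemma link_quad_le (f : {ffun d.-tuple 'I_n -> R}) (s : j.-tuple 'I_n) : cycles Y f ->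
  \sum_u \sum_v (ordering Y [tuple of v :: [tuple of u :: s]])%:R *
        (f [tuple of u :: s] * f [tuple of v :: s]) <= L * \sum_u f [tuple of u :: s] ^+ 2.
Proof.
move=> [ff bf]; have [f0 _] := ff.
pose x u := f [tuple of u :: s].
have fuv u : ~~ uniq (u :: s) -> x u = 0.
  by move=> nu; apply: f0; rewrite ordering_low.
have [us|nus] := boolP (uniq s); last first.
  rewrite big1 => [|u _]; last first.
    by rewrite big1 // => v _; rewrite -/(x u) fuv ?mul0r ?mulr0 //= (negPf nus) andbF.
  by rewrite mulr_ge0 // sumr_ge0 // => u _; exact: sqr_ge0.
pose rho := [set y in s]%SET.
have rd : #|rho|.+1 = d by rewrite uniq_card.
have x0 u : u \in rho -> x u = 0.
  by rewrite inE => uin; apply: fuv; rewrite /= uin.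
have sx : \sum_u x u = 0.
  have := congr1 (fun g : {ffun j.-tuple 'I_n -> R} => g s) bf.
  by rewrite boundaryE ?leqnSn // ffunE.
have E u v : (ordering Y [tuple of v :: [tuple of u :: s]])%:R * (x u * x v) =
    x u * link_mx p rho F u v * x v + p * (x u * x v) - p * (u == v)%:R * (x u * x v).
  have [ur|ur] := boolP (u \in rho); first by rewrite x0 //; ring.
  have [vr|vr] := boolP (v \in rho); first by rewrite (x0 v) //; ring.
  rewrite mxE /link_var /link_edge ordering_top.
  have us' : uniq [tuple of u :: s] by rewrite /= us andbT; move: ur; rewrite inE.
  have -> : uniq [tuple of v :: [tuple of u :: s]] = (u != v).
    move: ur vr; rewrite !inE /= us !inE => -> /negPf ->; by rewrite orbF !andbT eq_sym.
  rewrite cards2; have [->|uv] /= := eqVneq u v; first by ring.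
  have -> : [disjoint [set u; v]%SET & rho].
    by rewrite finset.disjoints_subset; apply/fintype.subsetP => y; rewrite !inE => /orP [] /eqP ->; rewrite ?inE in ur vr.
  have -> : (rho :|: [set u; v])%SET = [set y in [tuple of v :: [tuple of u :: s]]]%SET.
    apply/setP => y; rewrite !inE; case: (y == u); case: (y == v); rewrite ?orbT ?orbF //.
  by rewrite /=; ring.
rewrite (eq_bigr (fun u => \sum_v (x u * link_mx p rho F u v * x v + p * (x u * x v) - p * (u == v)%:R * (x u * x v)))); last first.
  by move=> u _; apply: eq_bigr => v _; exact: E.
have -> : \sum_u \sum_v (x u * link_mx p rho F u v * x v + p * (x u * x v) - p * (u == v)%:R * (x u * x v)) =
    quad (link_mx p rho F) (\col_u x u) - p * \sum_u x u ^+ 2.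
  rewrite quad_sum mulr_sumr -sumrB.
  transitivity (\sum_u (\sum_v x u * link_mx p rho F u v * x v - p * x u ^+ 2 + p * x u * \sum_v x v)).
    apply: eq_bigr => u _; rewrite sumrB big_split /= addrAC; congr (_ - _ + _).
      rewrite (bigD1 u) //= eqxx big1 ?addr0; last by move=> v /negPf; rewrite eq_sym => ->; rewrite mulr0 mul0r.
      by rewrite mulr1 expr2.
    by rewrite -mulr_sumr -mulr_sumr mulrA.
  by apply: eq_bigr => u _; rewrite sx mulr0 addr0.
have := good rd (\col_u x u).
have -> : nrm2 (\col_u x u) = \sum_u x u ^+ 2 by apply: eq_bigr => u _; rewrite mxE.
have : 0 <= p * \sum_u x u ^+ 2 by rewrite mulr_ge0 // sumr_ge0 // => u _; exact: sqr_ge0.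
by rewrite /x; lra.
Qed.

(** Pairing the eigenvalue equation with f, the degree part is at least m |f|^2. The links cost at
    most d L |f|^2, because the squared norms of the restrictions to all links add up to |f|^2. *)
Lemma spectrum_lower (f : {ffun d.-tuple 'I_n -> R}) (a m : R) : cycles Y f -> f != 0 ->
  (forall t, upper_laplacian Y f t = a * f t) ->
  (forall s : {set 'I_n}, #|s| = d -> m <= (deg Y d s)%:R) ->
  m - d%:R * L <= a.
Proof.
move=> cf fn0 ev mdeg; have [ff _] := cf; have [f0 _] := ff.
have S0 : 0 < \sum_t f t ^+ 2.
  rewrite lt0r sumr_ge0 ?andbT; last by move=> t _; exact: sqr_ge0.
  apply: contra fn0 => /eqP /psumr_eq0P H; apply/eqP/ffunP => t; rewrite ffunE.
  by apply/eqP; rewrite -sqrf_eq0 H // => u _; exact: sqr_ge0.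
rewrite -(ler_pM2r S0).
have <- : \sum_t f t * upper_laplacian Y f t = a * \sum_t f t ^+ 2.
  by rewrite mulr_sumr; apply: eq_bigr => t _; rewrite ev; ring.
rewrite laplacian_split // mulrBl; apply: lerB.
  rewrite mulr_sumr; apply: ler_sum => t _; have [ut|nut] := boolP (uniq t).
    by rewrite ler_wpM2r ?sqr_ge0 // mdeg // uniq_card.
  by rewrite f0 ?ordering_low // expr0n /= !mulr0.
rewrite -mulrA ler_wpM2l //.
have -> : \sum_t f t ^+ 2 = \sum_(s : j.-tuple 'I_n) \sum_u f [tuple of u :: s] ^+ 2.
  by rewrite sum_tuple_cons exchange_big.
by rewrite mulr_sumr; apply: ler_sum => s _; exact: link_quad_le.
Qed.

End LowerBound.

(** * The Rayleigh principle *)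

Section Rayleigh.
Variables (R : realType) (T : finType).
Implicit Types f g h : {ffun T -> R}.

Definition ip f h : R := \sum_t f t * h t.
Definition is_lin (l : {ffun T -> R} -> R) := forall a f h, l (a *: f + h) = a * l f + l h.

Lemma ipC f h : ip f h = ip h f.
Proof. by apply: eq_bigr => t _; rewrite mulrC. Qed.

Lemma ip_lin f : is_lin (ip f).
Proof.
move=> a g h; rewrite /ip mulr_sumr -big_split; apply: eq_bigr => t _ /=.
rewrite !ffunE -[a *: g t]/(a * g t); ring.
Qed.

Lemma ip_ge0 f : 0 <= ip f f.
Proof. by apply: sumr_ge0 => t _; rewrite -expr2 sqr_ge0. Qed.

Lemma ip_eq0 f : ip f f = 0 -> f = 0.
Proof.
move=> f0; apply/ffunP => t; rewrite ffunE; apply/eqP; rewrite -sqrf_eq0 expr2.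
apply/eqP; apply: (psumr_eq0P _ f0) => // u _; by rewrite -expr2 sqr_ge0.
Qed.

(** Passage to row vectors, where the compactness of cubes and the continuity of coordinates are
    used. *)
Let phi (x : 'rV[R]_#|T|) : {ffun T -> R} := [ffun t => x ord0 (enum_rank t)].
Let psi f : 'rV[R]_#|T| := \row_i f (enum_val i).

Let psiK f : phi (psi f) = f.
Proof. by apply/ffunP => t; rewrite ffunE mxE enum_rankK. Qed.

Lemma is_lin_expand l f : is_lin l -> l f = \sum_t f t * l [ffun u => (u == t)%:R].
Proof.
move=> ll; have l0 : l 0 = 0 by have := ll (-1) 0 0; rewrite scaler0 addr0 mulN1r addNr.
have {1}-> : f = \sum_t f t *: [ffun u => (u == t)%:R].
  apply/ffunP => t; rewrite sum_ffunE (bigD1 t) //= !ffunE eqxx big1 ?addr0 => [|u ut].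
    by rewrite -[_ *: _]/(f t * 1) mulr1.
  by rewrite !ffunE eq_sym (negPf ut) scaler0.
elim/big_rec2: _ => [//|t x y _ <-]; exact: ll.
Qed.

Lemma continuous_lin l : is_lin l -> continuous (l \o phi).
Proof.
move=> ll; have -> : l \o phi = fun x => \sum_t x ord0 (enum_rank t) * l [ffun u => (u == t)%:R].
  apply/funext => x /=; rewrite (is_lin_expand _ ll); apply: eq_bigr => t _; by rewrite ffunE.
apply: continuous_big => [|t _ x]; first exact: add_continuous.
apply: cvgMr_tmp; [exact: nbhs_filter | exact: coord_continuous].
Qed.

Variables (I : Type) (l : I -> {ffun T -> R} -> R) (D : {ffun T -> R} -> {ffun T -> R}).
Hypothesis l_lin : forall i, is_lin (l i).
Hypothesis D_lin : forall a f h, D (a *: f + h) = a *: D f + D h.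
(** Giving the subspace by linear equations makes it both closed and stable under linear
    combinations. *)
Definition ker f : Prop := forall i, l i f = 0.
Hypothesis D_ker : forall f, ker f -> ker (D f).
Hypothesis D_sym : forall f h, ker f -> ker h -> ip f (D h) = ip (D f) h.

Lemma kerD a f h : ker f -> ker h -> ker (a *: f + h).
Proof. by move=> kf kh i; rewrite l_lin kf kh mulr0 addr0. Qed.

Lemma kerZ a f : ker f -> ker (a *: f).
Proof.
move=> kf; rewrite -[a *: f]addr0; apply: kerD => // i.
by have := l_lin i (-1) 0 0; rewrite scaler0 addr0 mulN1r addNr.
Qed.

Lemma DZ a f : D (a *: f) = a *: D f.
Proof.
have D0 : D 0 = 0 by have := D_lin (-1) 0 0; rewrite scaler0 addr0 scaleN1r addNr.
by have := D_lin a f 0; rewrite !addr0 D0 addr0.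
Qed.

Lemma ipZ a b f h : ip (a *: f) (b *: h) = a * b * ip f h.
Proof.
rewrite /ip mulr_sumr; apply: eq_bigr => t _; rewrite !ffunE.
rewrite -[a *: f t]/(a * f t) -[b *: h t]/(b * h t); ring.
Qed.

(** The Rayleigh quotient attains its minimum mu on the compact unit sphere of the subspace, at some
    g. A variation of g in the direction of the residual w = D g - mu g shows that w = 0. *)
Lemma rayleigh_min f0 : ker f0 -> f0 != 0 ->
  exists mu f, [/\ ker f, f != 0, forall t, D f t = mu * f t &
    forall h, ker h -> mu * ip h h <= ip h (D h)].
Proof.
move=> kf0 nf0.
pose A := ([set x | ker (phi x)] `&` [set x | ip (phi x) (phi x) = 1])%classic.
have eval_lin t : is_lin (fun f => f t) by move=> a g h; rewrite !ffunE.
have Deval_lin t : is_lin (fun f => D f t) by move=> a g h; rewrite D_lin !ffunE.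
have cq (G : {ffun T -> R} -> {ffun T -> R}) : (forall t, is_lin (fun f => G f t)) ->
    continuous (fun x => ip (phi x) (G (phi x))).
  move=> lG; apply: continuous_big => [|t _ x]; first exact: add_continuous.
  apply: cvgM; first exact: nbhs_filter.
    exact: (continuous_lin (eval_lin t)).
  exact: (continuous_lin (lG t)).
have clA : closed A.
  apply: closedI.
    have -> : [set x | ker (phi x)]%classic = (\bigcap_i ((l i \o phi) @^-1` [set y | y = 0]))%classic.
      by apply/seteqP; split=> x /= H i; [move=> _; exact: H | exact: (H i Logic.I)].
    apply: closed_bigI => i _; apply: preimage_closed; last exact: closed_eq.
    by move=> x _; exact: (continuous_lin (l_lin i)).
  apply: (@preimage_closed _ _ (fun x => ip (phi x) (phi x)) [set y | y = 1]%classic).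
    by move=> x _; exact: (cq id eval_lin).
  exact: closed_eq.
have coA : compact A.
  apply: (subclosed_compact clA (rV_compact (fun _ : 'I_#|T| => @segment_compact R (-1) 1))).
  move=> x [_ /= x1] i; rewrite /= in_itv /= -ler_norml.
  rewrite -(@ler_pXn2r _ 2) ?nnegrE // expr1n real_normK ?num_real // -x1.
  rewrite /ip (bigD1 (enum_val i)) //= !ffunE enum_valK -expr2 lerDl.
  by apply: sumr_ge0 => t _; rewrite -expr2 sqr_ge0.
have normalise h : ker h -> h != 0 -> A (psi ((Num.sqrt (ip h h))^-1 *: h)).
  move=> kh nh; split; rewrite /= psiK; first exact: kerZ.
  have h0 : 0 < ip h h by rewrite lt0r ip_ge0 andbT; apply: contra nh => /eqP /ip_eq0 ->.
  by rewrite ipZ -expr2 exprVn sqr_sqrtr ?ltW // mulVf // gt_eqF.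
have A0 : (A !=set0)%classic by exists (psi ((Num.sqrt (ip f0 f0))^-1 *: f0)); exact: normalise.
have cont : ({within A, continuous (fun x => ip (phi x) (D (phi x)))})%classic.
  by apply: continuous_subspaceT; exact: cq.
have [x xA xmin] := compact_EVT_min A0 coA cont.
move: xA; rewrite inE => -[kx /= x1]; set g := phi x in kx x1.
set mu := ip g (D g).
have rq h : ker h -> mu * ip h h <= ip h (D h).
  move=> kh; have [->|nh] := eqVneq h 0.
    have D0 : D 0 = 0 by have := DZ 0 0; rewrite !scale0r.
    by rewrite D0 /ip !big1 ?mulr0 // => t _; rewrite ffunE mul0r.
  have h0 : 0 < ip h h by rewrite lt0r ip_ge0 andbT; apply: contra nh => /eqP /ip_eq0 ->.
  have := xmin _ (mem_set (normalise h kh nh)); rewrite psiK DZ ipZ -expr2 exprVn sqr_sqrtr ?(ltW h0) //.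
  rewrite -/g -/mu => H; rewrite -ler_pdivlMr //; apply: le_trans H _.
  by rewrite mulrC.
have gn0 : g != 0.
  by apply/eqP => g0; move: x1; rewrite g0 /ip big1 => [/eqP|t _]; rewrite ?ffunE ?mul0r // eq_sym oner_eq0.
exists mu, g; split=> // t.
pose w := (- mu) *: g + D g.
have kw : ker w by apply: kerD => //; exact: D_ker.
suff w0 : w = 0.
  have := congr1 (fun h : {ffun T -> R} => h t) w0.
  rewrite /w ffunE [X in X + _ = _]ffunE [in RHS]ffunE -[- mu *: g t]/(- mu * g t) mulNr => /eqP.
  by rewrite addrC subr_eq0 => /eqP.
apply: ip_eq0; set N := ip w w; have N0 : 0 <= N := ip_ge0 w.
set c := ip w (D w) - mu * N.
have c0 : 0 <= c by rewrite subr_ge0; exact: rq.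
(* This is the form of D - mu at tau w + g, nonnegative by minimality. *)
have var tau : 0 <= 2 * tau * N + tau ^+ 2 * c.
  have := rq (tau *: w + g) (kerD tau kw kx).
  have Dl u : ip u (tau *: w + g) = tau * ip u w + ip u g by exact: ip_lin.
  have Dl' u : ip u (tau *: D w + D g) = tau * ip u (D w) + ip u (D g) by exact: ip_lin.
  rewrite D_lin Dl Dl' !(ipC (tau *: w + g)) !Dl.
  rewrite -(ipC w g) -/N x1 (ipC (D w) w) (ipC (D w) g) (ipC (D g) g) -/mu (D_sym kx kw) (ipC (D g) w).
  have NE : N = - mu * ip w g + ip w (D g) by exact: ip_lin.
  rewrite /c; move: NE; set X := ip w g; set Y := ip w (D g); set Q := ip w (D w) => NE H.
  have YE : Y = N + mu * X by lra.
  move: H; rewrite YE; nra.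
apply/eqP; rewrite eq_le N0 andbT leNgt; apply/negP => Np.
(* For a small negative tau the linear term wins; the denominator c + 1 also covers c = 0. *)
have := var (- N / (c + 1)).
have c1 : 0 < c + 1 by lra.
have -> : 2 * (- N / (c + 1)) * N + (- N / (c + 1)) ^+ 2 * c = - (N ^+ 2 * (c + 2)) / (c + 1) ^+ 2.
  by field; rewrite gt_eqF.
rewrite ler_pdivlMr ?exprn_gt0 // mul0r oppr_ge0; apply/negP; rewrite -ltNge.
by rewrite mulr_gt0 ?exprn_gt0 //; lra.
Qed.

End Rayleigh.

(** * The spectral gap and the minimal degree *)

Lemma set_minE (R : realType) (A : set R) (m : R) :
  A m -> (forall x, A x -> m <= x) -> set_min A = m.
Proof.
move=> Am lm; apply: xget_subset1; first by split.
move=> x y [Ax lx] [Ay ly]; apply/eqP; rewrite eq_le; apply/andP; split.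
  exact: lx.
exact: ly.
Qed.

(** * The test cycle for the upper bound *)

Section TestForm.
Variables (R : realType) (n j : nat) (F : {set {set 'I_n}}) (sig : {set 'I_n}).
Local Notation d := j.+1.
Hypothesis sigd : #|sig| = d.
Local Notation Y := (complex_of d F).
Local Notation N := (nbrs F sig).
Local Notation Yf := (complex_of d (subsets_of_card n d.+1)).

Lemma sig_size : size (enum sig) == d.
Proof. by rewrite -cardE sigd. Qed.
Definition sig_tuple : d.-tuple 'I_n := Tuple sig_size.

Lemma mem_sig_tuple v : (v \in sig_tuple) = (v \in sig).
Proof. by rewrite /sig_tuple /= mem_enum. Qed.

Lemma sig_tuple_uniq : uniq sig_tuple.
Proof. exact: enum_uniq. Qed.

Definition chi (i : 'I_d.+1) (v : 'I_n) : R :=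
  oapp (fun m => (v == tnth sig_tuple m)%:R) (v \notin N)%:R (unlift ord0 i).

(* The coboundary of the indicator of [sig] in the complete complex on [~: N],
   written as a determinant whose first row is the indicator of [~: N]:
   repeating that row shows that it is closed. *)
Definition cone (t : d.+1.-tuple 'I_n) : R := \det (\matrix_(i, k) chi i (tnth t k)).

Lemma sig_notN v : v \in sig -> v \notin N.
Proof. by move=> vs; rewrite inE vs. Qed.

Lemma chi_N i v : v \in N -> chi i v = 0.
Proof.
move=> vN; rewrite /chi; case: unliftP => [m|] _ /=; last by rewrite vN.
case: eqVneq => // vE; move: vN; rewrite vE (negPf (sig_notN _)) //.
by rewrite -mem_sig_tuple mem_tnth.
Qed.

Lemma cone_perm s t : cone (perm_tuple s t) = (-1) ^+ s * cone t.
Proof.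
rewrite /cone; have -> : \matrix_(i, k) chi i (tnth (perm_tuple s t) k) =
    col_perm s (\matrix_(i, k) chi i (tnth t k)).
  by apply/matrixP => i k; rewrite !mxE tnth_mktuple.
by rewrite col_permE det_mulmx det_perm odd_permV mulrC.
Qed.

Lemma cone_N k t : tnth t k \in N -> cone t = 0.
Proof.
move=> tN; rewrite /cone (expand_det_col _ k) big1 // => i _.
by rewrite mxE chi_N // mul0r.
Qed.

Lemma cone_nonuniq (t : d.+1.-tuple 'I_n) : ~~ uniq t -> cone t = 0.
Proof.
move=> nu; have : ~~ injectiveb (tnth t) by rewrite /injectiveb /dinjectiveb; move: nu; rewrite -{1}(map_tnth_enum t).
case/injectivePn => a [b ab tab]; rewrite /cone -det_tr.
by apply: (determinant_alternate ab) => i; rewrite !mxE tab.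
Qed.

Lemma cone_forms : forms Yf [ffun t => cone t].
Proof.
split=> [t|t s]; last by rewrite !ffunE; exact: cone_perm.
rewrite ordering_top ffunE => nt; apply: cone_nonuniq; apply: contra nt => ut.
by rewrite ut /= inE uniq_card.
Qed.

Lemma cone_closed v (t : d.+1.-tuple 'I_n) : v \notin N -> (forall k, tnth t k \notin N) ->
  cone t = \sum_(i < d.+1) (-1) ^+ i * cone [tuple of v :: del i t].
Proof.
move=> vN tN.
pose w := [tuple of v :: t].
pose M : 'M[R]_d.+2 := \matrix_(i, k) oapp (chi^~ (tnth w k)) (tnth w k \notin N)%:R (unlift ord0 i).
have M0 : \det M = 0.
  have ne : (ord0 : 'I_d.+2) != lift ord0 ord0 by rewrite neq_lift.
  apply: (determinant_alternate ne) => k; rewrite !mxE unlift_none liftK /=.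
  by rewrite /chi unlift_none.
have : \sum_(k < d.+2) (-1) ^+ k * cone (del k w) = 0.
  rewrite -[RHS]M0 (expand_det_row _ ord0); apply: eq_bigr => k _.
  rewrite mxE unlift_none /=.
  have -> : tnth w k \notin N by case: (unliftP ord0 k) => [k'|] ->; rewrite ?tnth_cons_lift ?tN.
  rewrite mul1r /cofactor add0n; congr (_ * \det _).
  by apply/matrixP => a b; rewrite !mxE liftK /= tnth_mktuple.
rewrite big_ord_recl expr0 mul1r del_cons0 => /eqP; rewrite addr_eq0 => /eqP ->.
rewrite -sumrN; apply: eq_bigr => i _.
by rewrite del_cons_lift exprS mulN1r mulNr opprK.
Qed.

Definition test : {ffun d.-tuple 'I_n -> R} := boundary Yf [ffun t => cone t].

Lemma testE (t : d.-tuple 'I_n) : test t = \sum_(v | v \notin N) cone [tuple of v :: t].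
Proof.
rewrite /test boundaryE //; last exact: cone_forms.
rewrite [RHS]big_mkcond; apply: eq_bigr => v _; rewrite ffunE.
by case: ifPn => // /negPn vN; rewrite (@cone_N ord0).
Qed.

(** The boundary is taken in the complete complex [Yf]; it is a cycle of [Y] because both complexes
    have the same (d-1)-skeleton. *)
Lemma test_cycles : cycles Y test.
Proof.
have cf := cone_forms.
have [t0 tskew] : forms Yf test by exact: boundary_forms.
have ft : forms Y test.
  by split=> // t; rewrite ordering_low // => nt; apply: t0; rewrite ordering_low.
split=> //; apply/ffunP => t; rewrite boundaryE ?leqnSn //.
have := congr1 (fun g : {ffun j.-tuple 'I_n -> R} => g t) (boundary_boundary (leqnn _) cf).
by rewrite boundaryE ?leqnSn //; exact: boundary_forms.
Qed.

Lemma test_N k t : tnth t k \in N -> test t = 0.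
Proof.
move=> tN; rewrite testE big1 // => v _; apply: (@cone_N (lift ord0 k)).
by rewrite tnth_cons_lift.
Qed.

(** Used to see that the test cycle is nonzero. A vertex outside [N] and [sig] gives a triangular
    matrix with unit diagonal, and a vertex of [sig] a repeated column. *)
Lemma test_sig : test sig_tuple = (#|~: N :\: sig|%SET)%:R.
Proof.
rewrite testE -sum1_card natr_sum [RHS]big_mkcond [LHS]big_mkcond; apply: eq_bigr => v _ /=.
rewrite !finset.in_setD !finset.in_setC; case: ifPn => // vN; rewrite ?andbT ?andbF //.
have [vs|vs] /= := boolP (v \in sig).
  by rewrite cone_nonuniq //= mem_enum vs.
rewrite /cone -det_tr det_trig.
  rewrite big1 // => i _; rewrite !mxE /chi.
  case: unliftP => [m|] -> /=; last by rewrite vN.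
  by rewrite tnth_cons_lift eqxx.
apply/is_trig_mxP => a b ab; rewrite !mxE /chi.
case: (unliftP ord0 b) => [b'|] bE /=; last by move: ab; rewrite bE ltn0.
case: (unliftP ord0 a) => [a'|] aE.
  rewrite aE tnth_cons_lift (inj_eq (elimT (tuple_uniqP _) sig_tuple_uniq)).
  by case: eqVneq => // ab'; move: ab; rewrite aE bE ab' ltnn.
rewrite aE tnth_cons0; case: eqVneq => // vE; case/negP: vs.
by rewrite vE -mem_sig_tuple mem_tnth.
Qed.

(** If a vertex of [sig] is missing from t, its row vanishes. Otherwise the face t extends [sig] by
    one vertex, which then lies in [N]. *)
Lemma cone_face (t : d.+1.-tuple 'I_n) : uniq t -> [set x in t]%SET \in F -> (forall k, tnth t k \notin N) -> cone t = 0.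
Proof.
move=> ut tF tN; apply/eqP; apply: contraT => cn0.
have sub : sig \subset [set x in t]%SET.
  apply/fintype.subsetP => v; rewrite -mem_sig_tuple => /tnthP [m vE].
  rewrite inE; apply: contraR cn0 => vt; apply/eqP.
  rewrite /cone (expand_det_row _ (lift ord0 m)) big1 // => k _.
  rewrite mxE /chi liftK /= -vE; case: eqVneq => [kE|]; last by rewrite mul0r.
  by case/negP: vt; rewrite -kE mem_tnth.
have : #|[set x in t]%SET :\: sig|%SET = 1%N.
  by rewrite cardsD (finset.setIidPr sub) uniq_card // sigd subSnn.
move=> /eqP /cards1P [v tv].
have vin : v \in ([set x in t]%SET :\: sig)%SET by rewrite tv inE.
move: vin; rewrite !inE => /andP [vs /tnthP [k vk]].
have := tN k; rewrite -vk inE vs /= => /negP []; move: tF.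
by rewrite -{1}(finset.setID [set x in t]%SET sig) (finset.setIidPr sub) tv finset.setUC.
Qed.

(** On a face avoiding [N], closedness of the cone turns the coboundary into a multiple of [cone t],
    which is 0. On a face with a vertex in [N], only the term that deletes this vertex can survive,
    since the test cycle vanishes on tuples meeting [N]. *)
Lemma coboundary_test_le t :
  coboundary Y test t ^+ 2 <= \sum_(i < d.+1) (tnth t i \in N)%:R * test (del i t) ^+ 2.
Proof.
have rhs0 : 0 <= \sum_(i < d.+1) (tnth t i \in N)%:R * test (del i t) ^+ 2.
  by apply: sumr_ge0 => i _; rewrite mulr_ge0 ?sqr_ge0.
rewrite ffunE; case: ifPn => [ot|_]; last by rewrite expr0n.
have [/forallP tN|/forallPn [k /negPn tkN]] := boolP [forall k, tnth t k \notin N].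
  suff -> : \sum_(i < d.+1) (-1) ^+ i * test [tuple tnth t (lift i m) | m < d] = 0 by rewrite expr0n.
  have [ut tF] : uniq t /\ [set x in t]%SET \in F by apply/andP; rewrite -ordering_top.
  transitivity (\sum_(v | v \notin N) cone t); last first.
    by rewrite big1 // => v _; exact: cone_face.
  rewrite [RHS](eq_bigr (fun v => \sum_(i < d.+1) (-1) ^+ i * cone [tuple of v :: del i t])).
    by rewrite exchange_big; apply: eq_bigr => i _; rewrite testE mulr_sumr.
  by move=> v vN; exact: cone_closed.
rewrite (bigD1 k) //= big1 => [|i ik].
  rewrite addr0 exprMn sqrr_sign mul1r (bigD1 k) //= tkN mul1r lerDl.
  by apply: sumr_ge0 => i _; rewrite mulr_ge0 ?sqr_ge0.
have [k' kk' _] := unlift_some ik.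
by rewrite (@test_N k') ?mulr0 // tnth_mktuple -kk'.
Qed.

(** Each of the d + 1 positions contributes |N| |f|^2, which the factor of [adjoint] compensates. *)
Lemma test_rayleigh : \sum_t test t * upper_laplacian Y test t <= #|N|%:R * \sum_t test t ^+ 2.
Proof.
have [ft _] := test_cycles.
have d1 : (0 : R) < d.+1%:R by rewrite ltr0n.
rewrite -(ler_pM2l d1) laplacian_form //.
apply: (@le_trans _ _ (\sum_t \sum_(i < d.+1) (tnth t i \in N)%:R * test (del i t) ^+ 2)).
  by apply: ler_sum => t _; rewrite -expr2; exact: coboundary_test_le.
rewrite exchange_big /= (eq_bigr (fun=> #|N|%:R * \sum_t test t ^+ 2)) ?sumr_const ?card_ord ?mulr_natl //.
move=> i _; rewrite (sum_tuple_at i (fun v t => (v \in N)%:R * test t ^+ 2)).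
under eq_bigr do rewrite -mulr_sumr.
rewrite -mulr_suml -[RHS]mulr_natl; congr (_ * _); rewrite -sum1_card natr_sum [RHS]big_mkcond.
by apply: eq_bigr => v _; case: (v \in N).
Qed.

End TestForm.

(** * The gap as a minimum and its two-sided bound *)

Section Gap.
Variables (R : realType) (n j : nat) (F : {set {set 'I_n}}).
Local Notation d := j.+1.
Local Notation Y := (complex_of d F).
Implicit Types f h : {ffun d.-tuple 'I_n -> R}.

Lemma faces_low (s : {set 'I_n}) : (s \in faces Y j) = (#|s| == d)%N.
Proof.
rewrite !inE; case: eqP => [->|]; rewrite ?andbF ?andbT //; by rewrite leqnn.
Qed.

Lemma min_degP : (d <= n)%N -> exists s : {set 'I_n},
  [/\ #|s| = d, min_deg R d Y = (deg Y d s)%:R &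
     forall s' : {set 'I_n}, #|s'| = d -> (deg Y d s <= deg Y d s')%N].
Proof.
move=> dn.
have : (0 < #|[set A : {set 'I_n} | #|A| == d]%SET|)%N by rewrite card_draws card_ord bin_gt0.
move=> /card_gt0P [s0]; rewrite inE => s0d.
pose s := [arg min_(x < s0 | #|x| == d) deg Y d x].
have [sd smin] : #|s| = d /\ forall s' : {set 'I_n}, #|s'| = d -> (deg Y d s <= deg Y d s')%N.
  by rewrite /s; case: arg_minnP => // i /eqP id H; split=> // s' /eqP; exact: H.
exists s; split=> //; apply: set_minE.
  by exists s => //; rewrite faces_low sd.
by move=> x [s']; rewrite faces_low => /eqP s'd ->; rewrite ler_nat smin.
Qed.

(** The linear equations cutting out the cycles (support, skew symmetry, zero boundary) are indexed
    by one type so that [rayleigh_min] applies. *)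
Definition cycle_index := ((d.-tuple 'I_n) + (d.-tuple 'I_n) * 'S_d + (j.-tuple 'I_n))%type.
Definition cycle_form (i : cycle_index) f : R :=
  match i with
  | inl (inl t) => (~~ ordering Y t)%:R * f t
  | inl (inr (t, s)) => f [tuple tnth t (s k) | k < d] - (-1) ^+ s * f t
  | inr t => boundary Y f t
  end.

Lemma boundary_lin k a (f h : {ffun k.+1.-tuple 'I_n -> R}) :
  boundary Y (a *: f + h) = a *: boundary Y f + boundary Y h.
Proof.
apply/ffunP => t; rewrite !ffunE; case: ifP => _; last by rewrite scaler0 addr0.
by rewrite scaler_sumr -big_split; apply: eq_bigr => v _; rewrite !ffunE.
Qed.

Lemma coboundary_lin a f h :
  coboundary Y (a *: f + h) = a *: coboundary Y f + coboundary Y h.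
Proof.
apply/ffunP => t; rewrite !ffunE; case: ifP => _; last by rewrite scaler0 addr0.
rewrite scaler_sumr -big_split; apply: eq_bigr => v _ /=; rewrite !ffunE mulrDr.
by rewrite -![_ *: _]/(_ * _) mulrCA.
Qed.

Lemma cycle_formP f : cycles Y f <-> ker cycle_form f.
Proof.
split=> [[[f0 fs] bf] [[t|[t s]]|t] /=|K].
- by case: (boolP (ordering Y t)) => [|/f0 ->]; rewrite ?mul0r ?mulr0.
- by rewrite fs subrr.
- by rewrite bf ffunE.
split; first split.
- by move=> t nt; have := K (inl (inl t)); rewrite /= nt mul1r.
- by move=> t s; have /eqP := K (inl (inr (t, s))); rewrite /= subr_eq0 => /eqP.
by apply/ffunP => t; rewrite [RHS]ffunE; exact: (K (inr t)).
Qed.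

Lemma spectral_gapP f : cycles Y f -> f != 0 ->
  spectrum Y j (spectral_gap R d Y) /\
  forall h, cycles Y h ->
    spectral_gap R d Y * \sum_t h t ^+ 2 <= \sum_t h t * upper_laplacian Y h t.
Proof.
move=> cf fn0.
have sqE h : \sum_t h t ^+ 2 = ip h h by apply: eq_bigr => t _; rewrite expr2.
have l_lin i : is_lin (cycle_form i).
  have Z a g (t : d.-tuple 'I_n) : (a *: g : {ffun d.-tuple 'I_n -> R}) t = a * g t by rewrite ffunE.
  move=> a g h; case: i => [[t|[t s]]|t] /=.
  - by rewrite ffunE Z; ring.
  - by rewrite !ffunE -?[_ *: _]/(_ * _); move: ((-1) ^+ s : R) => e; ring.
  - by rewrite boundary_lin ffunE [X in X + _]ffunE.
have D_lin a g h : upper_laplacian Y (a *: g + h) = a *: upper_laplacian Y g + upper_laplacian Y h.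
  by rewrite /upper_laplacian coboundary_lin boundary_lin.
have D_ker g : ker cycle_form g -> ker cycle_form (upper_laplacian Y g).
  by move=> /cycle_formP [fg _]; apply/cycle_formP; exact: laplacian_cycles.
have D_sym g h : ker cycle_form g -> ker cycle_form h ->
    ip g (upper_laplacian Y h) = ip (upper_laplacian Y g) h.
  move=> /cycle_formP [fg _] /cycle_formP [fh _].
  have d1 : (d.+1%:R : R) != 0 by rewrite pnatr_eq0.
  apply: (mulfI d1); rewrite [in RHS]ipC /ip !laplacian_form //.
  by apply: eq_bigr => t _; rewrite mulrC.
have [mu [g [kg gn0 ev rq]]] := rayleigh_min l_lin D_lin D_ker D_sym (proj1 (cycle_formP f) cf) fn0.
have smu : spectrum Y j mu by exists g; split=> //; exact/cycle_formP.
have gapE : spectral_gap R d Y = mu.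
  apply: set_minE => // a [h [ch hn0 evh]].
  have h0 : 0 < ip h h by rewrite lt0r ip_ge0 andbT; apply: contra hn0 => /eqP /ip_eq0 ->.
  rewrite -(ler_pM2r h0); apply: le_trans (rq _ (proj1 (cycle_formP h) ch)) _.
  rewrite /ip mulr_sumr le_eqVlt; apply/orP; left; apply/eqP/eq_bigr => t _.
  by rewrite evh; ring.
by rewrite gapE; split=> // h ch; rewrite sqE; apply: rq; apply/cycle_formP.
Qed.

Lemma nbrs_subC (s : {set 'I_n}) : nbrs F s \subset (~: s)%SET.
Proof. by apply/fintype.subsetP => v; rewrite !inE => /andP []. Qed.

(** The strict bound on [L] excludes the complete complex, for which the test cycle would vanish. *)
Theorem gap_bounds (p L : R) : (d <= n)%N -> 0 <= p <= 1 -> 0 <= L -> L < (1 - p) * (n - d)%:R ->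
  (forall rho : {set 'I_n}, #|rho|.+1 = d ->
    forall x : 'cV[R]_n, quad (link_mx p rho F) x <= L * nrm2 x) ->
  min_deg R d Y - d%:R * L <= spectral_gap R d Y <= min_deg R d Y.
Proof.
move=> dn /andP [p0 p1] L0 Lsmall good.
have [sig [sd mE smin]] := min_degP dn.
have degE (s : {set 'I_n}) : #|s| = d -> deg Y d s = #|nbrs F s| by exact: deg_nbrs.
have subC (s : {set 'I_n}) : #|s| = d -> #|(~: s)%SET| = (n - d)%N.
  by move=> sd'; rewrite cardsCs finset.setCK sd' card_ord.
(* If the minimal degree were n - d, every (d+1)-set would be a face. The centred link matrix at the
   indicator of the complement of [rho] would then have Rayleigh quotient (1 - p)(n - d) > L. *)
have notfull : (#|nbrs F sig| < n - d)%N.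
  rewrite ltnNge; apply/negP => full; move: Lsmall; apply/negP; rewrite -leNgt.
  have allF (t : {set 'I_n}) : #|t| = d.+1 -> t \in F.
    move=> td; have /card_gt0P [v vt] : (0 < #|t|)%N by rewrite td.
    have tvd : #|t :\ v|%SET = d by have := cardsD1 v t; rewrite vt td add1n => -[].
    have fullt : nbrs F (t :\ v)%SET = (~: (t :\ v))%SET.
      apply/eqP; rewrite eqEcard nbrs_subC subC // -degE //.
      by apply: leq_trans full _; rewrite -degE // smin.
    have : v \in (~: (t :\ v))%SET by rewrite !inE eqxx.
    by rewrite -fullt inE => /andP [_]; rewrite finset.setD1K.
  have /card_gt0P [w ws] : (0 < #|sig|)%N by rewrite sd.
  pose rho := (sig :\ w)%SET.
  have rd : #|rho|.+1 = d by have := cardsD1 w sig; rewrite ws sd add1n => <-.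
  pose x (u : 'I_n) : R := (u \notin rho)%:R.
  have := good rho rd (\col_u x u).
  have cC : #|(~: rho)%SET| = (n - d).+1.
    by rewrite cardsCs finset.setCK card_ord; move: rd => [->]; rewrite subnSK.
  have sx : \sum_u x u = (n - d).+1%:R.
    rewrite -cC -sum1_card natr_sum [RHS]big_mkcond; apply: eq_bigr => u _.
    by rewrite finset.in_setC /x; case: (u \in rho).
  have xx u : x u ^+ 2 = x u by rewrite /x; case: (u \in rho); rewrite ?expr0n ?expr1n.
  have -> : nrm2 (\col_u x u) = (n - d).+1%:R.
    by rewrite -sx; apply: eq_bigr => u _; rewrite mxE xx.
  have -> : quad (link_mx p rho F) (\col_u x u) = (1 - p) * ((n - d).+1%:R * (n - d)%:R).
    rewrite quad_sum.
    transitivity (\sum_u (1 - p) * (x u * (\sum_v x v - 1))).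
      apply: eq_bigr => u _.
      have [ur|ur] := boolP (u \in rho).
        by rewrite /x ur /= mul0r mulr0 big1 // => v _; rewrite !mul0r.
      have x1 : x u = 1 by rewrite /x ur.
      rewrite (bigD1 u) //= [\sum_v x v](bigD1 u) //= x1 mulr1 mul1r.
      have -> : link_mx p rho F u u = 0.
        by rewrite mxE /link_var /link_edge cards2 eqxx.
      have -> : 1 + \sum_(v | v != u) x v - 1 = \sum_(v | v != u) x v by rewrite addrC addKr.
      rewrite add0r ?mul1r mulr_sumr; apply: eq_bigr => v vu.
      have [vr|vr] := boolP (v \in rho); first by rewrite /x vr /= !mulr0.
      rewrite mul1r mxE /link_var /link_edge cards2 [u == v]eq_sym vu /=.
      have -> : [disjoint [set u; v]%SET & rho].
        by rewrite finset.disjoints_subset; apply/fintype.subsetP => y; rewrite finset.in_setC in_set2 => /orP [] /eqP ->.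
      rewrite allF //.
      have -> : (rho :|: [set u; v])%SET = (u |: (v |: rho))%SET.
        by apply/setP => y; rewrite !inE orbC -orbA.
      by rewrite cardsU1 in_setU1 [u == v]eq_sym (negPf vu) (negPf ur) cardsU1 vr /= !add1n rd.
    rewrite -mulr_sumr -mulr_suml sx; congr (_ * (_ * _)).
    by rewrite -addn1 natrD addrK.
  by rewrite mulrCA [L * _]mulrC ler_pM2l // ltr0n.
have [ct ctN] : cycles Y (test R F sd) /\ test R F sd != 0.
  split; first exact: test_cycles.
  apply/eqP => t0; have := test_sig R F sd; rewrite t0 ffunE => /esym /eqP.
  rewrite pnatr_eq0 cards_eq0 finset.setD_eq0 => sub.
  have := subset_leq_card sub; rewrite sd => h1.
  have := cardsC (nbrs F sig); rewrite card_ord => h2; lia.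
have [gspec gray] := spectral_gapP ct ctN.
apply/andP; split.
  have [g [cg gn0 ev]] := gspec.
  apply: (spectrum_lower p0 L0 good cg gn0 ev) => s sd'.
  by rewrite mE ler_nat smin.
have S0 : 0 < \sum_t test R F sd t ^+ 2.
  rewrite lt0r sumr_ge0 ?andbT; last by move=> t _; exact: sqr_ge0.
  apply: contra ctN => /eqP S0; apply/eqP/ip_eq0; rewrite -S0.
  by apply: eq_bigr => t _; rewrite expr2.
rewrite mE degE // -(ler_pM2r S0).
exact: le_trans (gray _ ct) (test_rayleigh R F sd).
Qed.

End Gap.

(** * The union bound *)

Section Tail.
Variables (R : realType) (n d : nat) (p : R).
Hypothesis p01 : 0 <= p <= 1.
Local Notation S := (subsets_of_card n d.+1).

Definition good_trace m (B : R) (F : {set {set 'I_n}}) : bool :=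
  [forall rho : {set 'I_n}, (#|rho|.+1 == d) ==> (\tr (link_mx p rho F ^+ m) <= B)].

Lemma trace_even_ge0 (M : 'M[R]_n) k : M^T = M -> 0 <= \tr (M ^+ k.*2).
Proof.
move=> sM; have sMk : (M ^+ k)^T = M ^+ k.
  by elim: k => [|k IH]; [rewrite trmx1 | rewrite exprS trmx_mul IH sM -exprS exprSr].
rewrite -addnn exprD; apply: sumr_ge0 => i _; rewrite mxE; apply: sumr_ge0 => j _.
by rewrite -{1}sMk mxE -expr2 sqr_ge0.
Qed.

(** Markov's inequality, the traces of even powers being nonnegative, summed over at most n^(d-1)
    faces [rho]. Each expected trace is at most n times the walk count, hence the factor n^d. *)
Lemma good_trace_prob k r (B : R) : 0 < B ->
  n%:R * p + k.*2%:R <= r%:R -> (k.*2 < r)%N -> (0 < d)%N ->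
  1 - n%:R ^+ d * (doubled_walks k.*2 'I_r)%:R / B <=
  expect S p (fun F => (good_trace k.*2 B F)%:R).
Proof.
move=> B0 nr kr d0.
pose X F := \sum_(rho : {set 'I_n} | #|rho|.+1 == d) B^-1 * \tr (link_mx p rho F ^+ k.*2).
have term_ge0 (rho : {set 'I_n}) F : 0 <= B^-1 * \tr (link_mx p rho F ^+ k.*2).
  apply: mulr_ge0; first by rewrite invr_ge0 ltW.
  by apply: trace_even_ge0; exact: link_mx_sym.
have H1 : 1 <= expect S p (fun F => (good_trace k.*2 B F)%:R) + expect S p X.
  rewrite -[leLHS](expect_cst S p 1) /expect -big_split /=; apply: ler_sum => F _.
  rewrite -mulrDr ler_wpM2l ?wt_ge0 //.
  have [_|/forallPn [rho]] := boolP (good_trace _ _ _).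
    by rewrite lerDl sumr_ge0.
  rewrite negb_imply -ltNge => /andP [rd trB]; rewrite add0r /X (bigD1 rho) //=.
  by rewrite ler_wpDr ?sumr_ge0 // mulrC ler_pdivlMr // mul1r ltW.
have H2 : expect S p X <= n%:R ^+ d * (doubled_walks k.*2 'I_r)%:R / B.
  rewrite expect_sum.
  apply: (@le_trans _ _ (\sum_(rho : {set 'I_n} | #|rho|.+1 == d) B^-1 * (n%:R * (doubled_walks k.*2 'I_r)%:R))).
    apply: ler_sum => rho /eqP rd; rewrite expectZ ler_wpM2l ?invr_ge0 ?(ltW B0) //.
    exact: expect_link_trace.
  rewrite sumr_const -[leLHS]mulr_natl.
  have cardle : (#|[pred rho : {set 'I_n} | #|rho|.+1 == d]| <= n ^ d.-1)%N.
    have -> : #|[pred rho : {set 'I_n} | #|rho|.+1 == d]| = 'C(n, d.-1).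
      rewrite -[n in RHS]card_ord -card_draws; apply: eq_card => rho; rewrite !inE.
      by rewrite -[in RHS]eqSS prednK.
    apply: leq_trans (ffact_le_expn n d.-1); rewrite -bin_ffact leq_pmulr ?fact_gt0 //.
  have -> : n%:R ^+ d * (doubled_walks k.*2 'I_r)%:R / B =
     n%:R ^+ d.-1 * (B^-1 * (n%:R * (doubled_walks k.*2 'I_r)%:R)).
    by rewrite -{1}(prednK d0) exprS; ring.
  rewrite ler_wpM2r ?mulr_ge0 ?invr_ge0 ?(ltW B0) // -natrX ler_nat; exact: cardle.
by rewrite lerBlDr; apply: le_trans H1 _; rewrite lerD2l.
Qed.

Lemma good_trace_quad e (L : R) F : 0 <= L -> good_trace (2 ^ e.+1) (L ^+ (2 ^ e.+1)) F ->
  forall rho : {set 'I_n}, #|rho|.+1 = d ->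
  forall x : 'cV[R]_n, quad (link_mx p rho F) x <= L * nrm2 x.
Proof.
move=> L0 /forallP G rho rd x; have /implyP/(_ (introT eqP rd)) tr := G rho.
have N0 := nrm2_ge0 x; have LN0 : 0 <= L * nrm2 x by rewrite mulr_ge0.
have [q0|q0] := lerP 0 (quad (link_mx p rho F) x); last exact: le_trans (ltW q0) LN0.
rewrite -(@ler_pXn2r _ (2 ^ e.+1)) ?expn_gt0 ?nnegrE //.
apply: le_trans (quad_le_trace x e (link_mx_sym p rho F)) _.
by rewrite exprMn ler_wpM2r ?exprn_ge0.
Qed.

End Tail.

(** * Choice of the parameters *)

Section Numerics.
Variable R : realType.

(** With l = ln n, the moment m = 2k is a power of two with l < m <= 3l, and r <= a l. Since T^2 = a
    e^b, the denominator is (a l)^k e^(b k): the first factor absorbs r^k, the second is at least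
    e^(b l/2). *)
Lemma tail_numeric (c : R) (d : nat) : 0 < c -> exists2 T : R, 0 < T & exists K : R,
  forall n : nat, 2 <= ln (n%:R : R) -> exists e r : nat,
  [/\ c * ln n%:R + (2 ^ e.+1)%:R <= r%:R, (2 ^ e.+1 < r)%N &
     n%:R ^+ d * (doubled_walks (2 ^ e.+1) 'I_r)%:R / (T * Num.sqrt (ln n%:R)) ^+ (2 ^ e.+1) <= K / n%:R].
Proof.
have [q qE q0] : exists2 q : R, q = 1318 & 0 <= q by exists 1318; rewrite ?ler0n.
(* In [a], the 4 pays for m <= 3l and for rounding c l up. In b/2, d pays for n^d, q a for the
   exponential of [doubled_walks_le], and 2 for l <= e^l and the remaining 1/n. *)
move=> c0; pose a : R := c + 4; pose b : R := 2 * (d%:R + q * a + 2).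
have a0 : 0 < a by rewrite /a; lra.
have b0 : 0 < b.
  have dR : (0 : R) <= d%:R by [].
  have : 0 <= q * a by rewrite mulr_ge0 // ltW.
  by rewrite /b; lra.
have T20 : 0 < a * expR b by rewrite mulr_gt0 ?expR_gt0.
exists (Num.sqrt (a * expR b)); first by rewrite sqrtr_gt0.
exists (2 * a) => n l2; set l := ln n%:R in l2 *.
have l0 : 0 < l by lra.
have n0 : 0 < (n%:R : R).
  by rewrite ltNge; apply/negP => /ln0 nl; move: l0; rewrite /l nl ltxx.
have nE : n%:R = expR l by rewrite lnK.
pose N0 := (Num.truncn l).+1.
have [N1 N2] : l < N0%:R /\ N0%:R <= l + 1.
  have := truncn_itv (ltW l0); rewrite /N0 -[_.+1]addn1 natrD => /andP [h1 h2].
  by split; lra.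
have N0gt : (0 < N0)%N by [].
have /andP [e1 e2] := trunc_log_bounds (isT : (1 < 2)%N) N0gt.
set e := trunc_log 2 N0 in e1 e2; pose m := (2 ^ e.+1)%N.
have mk : m = (2 ^ e).*2 by rewrite /m expnS mul2n.
have ml : l < m%:R by apply: lt_trans N1 _; rewrite ltr_nat.
have m3 : m%:R <= 3 * l.
  have : m%:R <= 2 * N0%:R :> R by rewrite mk -mul2n natrM ler_wpM2l // ler_nat.
  lra.
pose r := ((Num.truncn (c * l)).+1 + m)%N.
have cl0 : 0 <= c * l by rewrite mulr_ge0 ?ltW.
have [r1 r2] : c * l + m%:R <= r%:R /\ r%:R <= a * l.
  have := truncn_itv cl0; rewrite /r natrD -[_.+1]addn1 natrD /a mulrDl => /andP [h1 h2].
  by split; lra.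
have mr : (m < r)%N by rewrite /r addSn ltnS leq_addl.
exists e, r; rewrite -/m; split=> //.
have r0 : (0 < r)%N by [].
set k := (2 ^ e)%N in mk; clearbody r; clearbody m; clearbody k.
have LE : (Num.sqrt (a * expR b) * Num.sqrt l) ^+ m = (a * l) ^+ k * expR (b * k%:R).
  rewrite mk -mul2n exprM [(_ * _) ^+ 2]exprMn !sqr_sqrtr ?(ltW T20) ?(ltW l0) //.
  by rewrite mulrAC exprMn expRM_natr.
have al0 : 0 < a * l by rewrite mulr_gt0.
rewrite LE ler_pdivrMr ?mulr_gt0 ?exprn_gt0 ?expR_gt0 //.
have kr : (k.*2 <= r)%N by rewrite -mk ltnW.
have D := doubled_walks_le R r0 kr; rewrite -mk -qE in D.
have rR : (0 : R) <= r%:R by [].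
apply: (@le_trans _ _ (expR (d%:R * l) * (2 * (a * l) * (a * l) ^+ k * expR (q * (a * l))))).
  have -> : n%:R ^+ d = expR (d%:R * l) by rewrite nE expRM_natl.
  rewrite ler_wpM2l ?expR_ge0 //; apply: le_trans D _.
  apply: ler_pM; rewrite ?expR_ge0 ?mulr_ge0 ?exprn_ge0 //; last first.
    by rewrite ler_expR; exact: ler_wpM2l r2.
  apply: ler_pM; rewrite ?mulr_ge0 ?exprn_ge0 //; first by rewrite ler_wpM2l.
  by rewrite lerXn2r ?nnegrE // ltW.
have lexp : l <= expR l by apply: le_trans (expR_ge1Dx l); rewrite lerDr.
have bk : b * l / 2 <= b * k%:R.
  by rewrite -mulrA ler_pM2l // ler_pdivrMr // mulrC -natrM mul2n -mk (ltW ml).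
have -> : 2 * a / n%:R * ((a * l) ^+ k * expR (b * k%:R)) =
   (2 * a * (a * l) ^+ k) * (expR (- l) * expR (b * k%:R)) by rewrite nE expRN; ring.
have -> : expR (d%:R * l) * (2 * (a * l) * (a * l) ^+ k * expR (q * (a * l))) =
   (2 * a * (a * l) ^+ k) * (expR (d%:R * l) * l * expR (q * (a * l))) by ring.
rewrite ler_wpM2l ?mulr_ge0 ?exprn_ge0 ?(ltW a0) ?(ltW al0) //.
apply: (@le_trans _ _ (expR (d%:R * l) * expR l * expR (q * (a * l)))).
  by rewrite ler_wpM2r ?expR_ge0 // ler_wpM2l ?expR_ge0.
rewrite -!expRD ler_expR; apply: le_trans (_ : - l + b * l / 2 <= _); last by rewrite lerD2l.
by rewrite le_eqVlt; apply/orP; left; apply/eqP; rewrite /b; field.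
Qed.

(** All bounds follow from ln n <= 2 sqrt n once sqrt n >= Q; the summand e^2 of the threshold gives
    ln n >= 2. *)
Lemma large_n (c T : R) (d : nat) : 0 < c -> 0 < T -> exists M : R, forall n : nat, M <= n%:R ->
  [/\ (d <= n)%N, 2 <= ln (n%:R : R), 0 <= c * ln n%:R / n%:R <= 1 / 2 &
    T * Num.sqrt (ln n%:R) < (1 - c * ln n%:R / n%:R) * (n - d)%:R].
Proof.
move=> c0 T0; have d0 : (0 : R) <= d%:R by [].
pose Q : R := 4 * c + 4 * T + d%:R + 1.
have Q0 : 0 <= Q by rewrite /Q; lra.
exists (Q ^+ 2 + expR 2) => n nM; set x : R := n%:R in nM *.
have e0 := expR_gt0 (2 : R).
have x0 : 0 < x by have := sqr_ge0 Q; lra.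
pose s := Num.sqrt x; have s0 : 0 < s by rewrite sqrtr_gt0.
have sE : s ^+ 2 = x by rewrite sqr_sqrtr // ltW.
have sQ : Q <= s by rewrite -(@ler_pXn2r _ 2) ?nnegrE // ?(ltW s0) // sE; lra.
set l := ln x.
have l2 : 2 <= l by rewrite -[leLHS]expRK /l ler_ln ?posrE //; have := sqr_ge0 Q; lra.
have ls : l <= 2 * s.
  rewrite /l -sE lnXn // mulr_natl mulr2n; have := ltW (ln_sublinear s0); lra.
have s1 : 1 <= s by apply: le_trans sQ; rewrite /Q; lra.
have sx : 4 * T * s + d%:R < x.
  rewrite -sE expr2; move: sQ; rewrite /Q => sQ.
  have : (4 * c + 4 * T + d%:R + 1) * s <= s * s by rewrite ler_pM2r.
  have : d%:R * 1 <= d%:R * s by rewrite ler_wpM2l.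
  have : 0 <= c * s by rewrite mulr_ge0 // ltW.
  rewrite !mulrDl !mul1r; lra.
have dn : (d <= n)%N.
  have Ts : 0 <= T * s by rewrite mulr_ge0 // ltW.
  by rewrite -(ler_nat R) -/x; lra.
have p2 : c * l / x <= 1 / 2.
  rewrite ler_pdivrMr // -sE expr2.
  have : c * l <= c * (2 * s) by rewrite ler_pM2l.
  have : 4 * c * s <= s * s by rewrite ler_pM2r // (le_trans _ sQ) // /Q; lra.
  lra.
have p0 : 0 <= c * l / x by rewrite divr_ge0 ?mulr_ge0 ?ltW //; lra.
split=> //; first by rewrite p0.
rewrite natrB // -/x.
have sl : Num.sqrt l <= l.
  rewrite -(@ler_pXn2r _ 2) ?nnegrE ?sqrtr_ge0 //; last by lra.
  rewrite sqr_sqrtr; last by lra.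
  by rewrite expr2 ler_peMr; lra.
have h1 : T * Num.sqrt l <= T * (2 * s) by rewrite ler_pM2l // (le_trans sl).
have h2 : 1 / 2 * (x - d%:R) <= (1 - c * l / x) * (x - d%:R).
  have Ts : 0 <= T * s by rewrite mulr_ge0 // ltW.
  by rewrite ler_wpM2r //; lra.
apply: le_lt_trans h1 (lt_le_trans _ h2); lra.
Qed.

End Numerics.

Theorem theorem4p1 (R : realType) (d : nat) (eps : R)
    (hd : (2 <= d)%N) (heps : 0 < eps) :
  exists2 C : R, 0 < C &
    whp (fun n => (1 + eps) * d%:R * ln n%:R / n%:R) d
      (fun n (Y : {set {set 'I_n}}) =>
         min_deg R d Y - C * Num.sqrt (ln n%:R) <= spectral_gap R d Y
           <= min_deg R d Y).
Proof.
case: d hd => [//|j] _.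
pose c : R := (1 + eps) * j.+1%:R.
have c0 : 0 < c by rewrite mulr_gt0 // ?ltr0n //; lra.
have [T T0 [K HK]] := tail_numeric j.+1 c0.
have [M HM] := large_n j.+1 c0 T0.
(* C = d T: the link forms are bounded by L = T sqrt(ln n), and [gap_bounds] loses d L. *)
exists (j.+1%:R * T); first by rewrite mulr_gt0 ?ltr0n.
pose E n (Y : {set {set 'I_n}}) : Prop :=
  min_deg R j.+1 Y - j.+1%:R * T * Num.sqrt (ln n%:R) <= spectral_gap R j.+1 Y <= min_deg R j.+1 Y.
suff : whp (fun n => c * ln n%:R / n%:R) j.+1 E by [].
apply/cvgrPdist_le => z z0; near=> n.
have nM : M <= n%:R by near: n; exact: nbhs_infty_ger.
(* The failure probability is at most K/n, which this makes at most z. *)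
have nz : K / z <= n%:R by near: n; exact: nbhs_infty_ger.
have [dn l2 /andP [p0 p2] Ln] := HM n nM.
set p : R := c * ln n%:R / n%:R in p0 p2 Ln.
have p01 : 0 <= p <= 1 by rewrite p0; lra.
have nn0 : (0 < n)%N by apply: leq_trans dn.
have n0 : (0 : R) < n%:R by rewrite ltr0n.
have [e [r [h1 h2 h3]]] := HK n l2.
set L := T * Num.sqrt (ln n%:R) in Ln h3.
have L0 : 0 < L by rewrite mulr_gt0 // sqrtr_gt0; lra.
have good_sub (F : {set {set 'I_n}}) :
    good_trace j.+1 p (2 ^ e.+1) (L ^+ (2 ^ e.+1)) F -> E n (complex_of j.+1 F).
  move=> G; rewrite /E -mulrA -/L.
  exact: (gap_bounds dn p01 (ltW L0) Ln (good_trace_quad (ltW L0) G)).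
have wt0 := wt_ge0 (subsets_of_card n j.+2) p01.
have prob_le1 : prob_Y p j.+1 (@E n) <= 1.
  rewrite -(expect_cst (subsets_of_card n j.+2) p 1) /prob_Y /expect [leLHS]big_mkcondr /=.
  by apply: ler_sum => F _; rewrite mulr1; case: ifP => // _; exact: wt0.
have prob_ge : 1 - K / n%:R <= prob_Y p j.+1 (@E n).
  apply: (@le_trans _ _ (expect (subsets_of_card n j.+2) p
      (fun F => (good_trace j.+1 p (2 ^ e.+1) (L ^+ (2 ^ e.+1)) F)%:R))).
    have m2 : (2 ^ e.+1)%N = (2 ^ e).*2 by rewrite expnS mul2n.
    have np : n%:R * p = c * ln n%:R by rewrite /p mulrCA mulfV ?mulr1 // gt_eqF.
    apply: le_trans (_ : 1 - n%:R ^+ j.+1 * (doubled_walks (2 ^ e.+1) 'I_r)%:R / L ^+ (2 ^ e.+1) <= _).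
      by rewrite lerD2l lerN2.
    move: h1 h2; rewrite -np m2 => h1 h2.
    by apply: good_trace_prob => //; rewrite exprn_gt0.
  rewrite /prob_Y /expect [leRHS]big_mkcondr /=; apply: ler_sum => F _.
  have [G|_] := boolP (good_trace _ _ _ _ F); last by rewrite mulr0; case: ifP => // _; exact: wt0.
  by rewrite mulr1 (asboolT (good_sub F G)).
have Kn : K / n%:R <= z by rewrite ler_pdivrMr // mulrC -ler_pdivrMr.
rewrite -/p ger0_norm; last by rewrite subr_ge0.
lra.
Unshelve. all: by end_near.
Qed.
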